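(* Let $\Omega\subset\mathbb{C}$ be a hyperbolic domain. Then the density function $\overline{\eta}_\Omega$ is a lower semi-continuous function on $\Omega$.
   Context: A domain is a nonempty open connected subset of $\mathbb{C}$; a domain $\Omega\subset\mathbb{C}$ is hyperbolic if its complement $\Omega^c=\mathbb{C}\setminus\Omega$ contains at least two points. $\mathbb{D}=\{z\in\mathbb{C}:|z|<1\}$ and $\mathbb{D}^*=\mathbb{D}\setminus\{0\}$. Hurwitz density: for a domain $\Omega\subsetneq\mathbb{C}$ and $w\in\Omega$, let $\mathcal{H}_0^w(\mathbb{D},\Omega)$ be the collection of all holomorphic functions $f:\mathbb{D}\to\Omega$ such that $f(0)=w$, $f(s)\neq w$ for all $s\in\mathbb{D}^*$, and $f'(0)>0$. Put $r_\Omega(w)=\max\{f'(0): f\in\mathcal{H}_0^w(\mathbb{D},\Omega)\}$ (the maximum is known to exist) and $\eta_\Omega(w)=2/r_\Omega(w)$. For a hyperbolic domain $\Omega$ and $w\in\Omega$, $$\overline{\eta}_\Omega(w)=\sup\,\eta_{\mathbb{C}\setminus\{w_1,w_2\}}(w),$$ where the supremum is taken over all pairs of distinct points $w_1,w_2\in\Omega^c$. *)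

(* Defs.v *)
From HB Require Import structures.
From mathcomp Require Import all_boot all_order all_algebra complex.
From mathcomp Require Import boolp classical_sets reals constructive_ereal ereal.
From mathcomp Require Import topology normedtype derive.

Set Implicit Arguments.
Unset Strict Implicit.
Unset Printing Implicit Defensive.

Import Order.TTheory GRing.Theory Num.Theory numFieldNormedType.Exports.

Local Open Scope classical_set_scope.
Local Open Scope complex_scope.
Local Open Scope ring_scope.

(* Packaging [R[i]] as a [numClosedFieldType] gives it the topology of its norm
   and makes it a normed module over itself, so that [derivable f z 1] and
   [derive1 f z] below are complex differentiability and the complex derivative.
   The order of [Cplx R] is partial: [0 < z] says that [z] is real and positive. *)
Definition Cplx (R : realType) : numClosedFieldType := R[i].

Section HurwitzDensity.
Context {R : realType}.
Local Notation C := (Cplx R).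
Implicit Types (Omega D : set C) (w z : C) (f : C -> C).

Definition domain Omega := [/\ Omega !=set0, open Omega & connected Omega].

Definition hyperbolic Omega :=
  exists w1 w2 : C, [/\ w1 != w2, ~ Omega w1 & ~ Omega w2].

Definition unit_disk : set C := [set z | `|z| < 1].

(* Meant for open [D], where it does not depend on the values of [f] off [D]. *)
Definition holomorphic_on D f := forall z, D z -> derivable f z 1.

Definition hurwitz_family Omega w : set (C -> C) :=
  [set f | [/\ holomorphic_on unit_disk f,
               (forall z, unit_disk z -> Omega (f z)),
               f 0 = w,
               (forall s, unit_disk s -> s != 0 -> f s != w) &
               0 < derive1 f 0]].

(* For a domain [Omega] other than the whole plane and [w] in [Omega], the
   supremum is attained: it is the maximum of the derivatives at 0. *)
Definition hurwitz_radius Omega w : R :=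
  sup [set r : R | exists2 f, hurwitz_family Omega w f & derive1 f 0 = r%:C].

Definition hurwitz_density Omega w : R := 2 / hurwitz_radius Omega w.

(* The supremum is taken in the extended reals, so that no boundedness is needed
   for it to be meaningful. *)
Definition hurwitz_sup_density Omega w : \bar R :=
  ereal_sup [set x | exists w1 w2 : C,
    [/\ w1 != w2, ~ Omega w1, ~ Omega w2 &
        x = (hurwitz_density (~` [set w1; w2]) w)%:E]].

End HurwitzDensity.

(* Main.v *)
Require Import Defs.
From mathcomp Require Import all_boot all_order all_algebra.
From mathcomp Require Import classical_sets reals constructive_ereal ereal.
From mathcomp Require Import topology normedtype.
From mathcomp Require Import complex ring lra.
From mathcomp Require Import all_classical all_reals all_analysis.
Import Order.TTheory GRing.Theory Num.Theory numFieldNormedType.Exports.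

(** A supremum of lower semicontinuous functions is lower semicontinuous, so the
    point is that, for two distinct points [w1] and [w2], the Hurwitz density of
    the plane without [w1] and [w2] is lower semicontinuous, that is, that the
    radius [r w] (the largest derivative at 0 in the family at [w]) is upper
    semicontinuous and finite.

    The usual proof extracts a limit from a normal family.  It is replaced here
    by an explicit deformation ([hurwitz_radius_usc]).  A quadratic polynomial
    close to the identity fixes [w1] and [w2] and sends [w] to [w0].  Composing a
    member [f] of the family at [w], restricted to a slightly smaller disc, with
    this polynomial yields a member of the family at [w0] whose derivative at 0 is
    almost the same.  The polynomial is injective only on bounded sets, so a bound
    for [f] on smaller discs is needed which is uniform in [f] and in [w] near
    [w0]: this is Schottky's theorem ([schottky], [schottky_pair]).  The same bound
    gives the finiteness of [r w] ([derivative_set_bounded]).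

    Schottky's theorem is proved along Landau's lines.  If [f] omits 0 and 1 then
    [log f / (2 pi i)] omits the integers, hence equals [cosh ^ 2 G] where [G] omits a
    net of points meeting every disc of radius 8 ([cosh_net]).  A form of Bloch's
    theorem ([bloch_landau]) bounds the derivative of such a [G], and [f] is
    recovered from [G].  Bloch's theorem follows from two facts about functions that
    are only assumed complex differentiable: a function without zeros on a disc has
    a holomorphic logarithm on smaller discs ([exists_hol_log]), and the Cauchy
    estimate [cabs (f' a) * r <= K * sup (cabs f)] holds with some universal constant
    [K] ([cauchy_estimate]).  The latter comes from Goursat's theorem on squares
    ([goursat_square]), applied in logarithmic coordinates. *)

Set Implicit Arguments.
Unset Strict Implicit.
Unset Printing Implicit Defensive.

Local Open Scope classical_set_scope.
Local Open Scope complex_scope.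
Local Open Scope ring_scope.

(** * The complex plane with a real-valued modulus *)

Section Plane.
Context {R : realType}.
Local Notation C := (Cplx R).
Implicit Types (x y e : R) (z w : C).

(** The norm of [Cplx R] takes its values in [Cplx R], whose order is only
    partial; estimates are made with this modulus valued in [R] instead. *)
Definition cabs z : R := Normc.normc (z : R[i]).

Definition cart x y : C := (x +i* y)%C.

Lemma cabsE z : `|z| = cart (cabs z) 0.
Proof. by []. Qed.

Lemma cartD x y x' y' : cart x y + cart x' y' = cart (x + x') (y + y').
Proof. by []. Qed.

Lemma cartN x y : - cart x y = cart (- x) (- y).
Proof. by []. Qed.

Lemma cartB x y x' y' : cart x y - cart x' y' = cart (x - x') (y - y').
Proof. by []. Qed.

Lemma cartM x y x' y' :
  cart x y * cart x' y' = cart (x * x' - y * y') (x * y' + y * x').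
Proof. by []. Qed.

Lemma cart0 : cart 0 0 = 0. Proof. by []. Qed.
Lemma cart1 : cart 1 0 = 1. Proof. by []. Qed.

Lemma cart_nat n : cart n%:R 0 = n%:R.
Proof.
by elim: n => // n IH; rewrite -!natr1 -IH -cart1 cartD addr0.
Qed.

Lemma cabs_ge0 z : 0 <= cabs z.
Proof. by case: z => a b; rewrite sqrtr_ge0. Qed.

Lemma cabs_cart x y : cabs (cart x y) = Num.sqrt (x ^+ 2 + y ^+ 2).
Proof. by []. Qed.

Lemma cabs_real x : cabs (cart x 0) = `|x|.
Proof. by rewrite cabs_cart expr0n /= addr0 sqrtr_sqr. Qed.

Lemma cabs0 : cabs 0 = 0.
Proof. by rewrite -cart0 cabs_real normr0. Qed.

Lemma cabs1 : cabs 1 = 1.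
Proof. by rewrite -cart1 cabs_real normr1. Qed.

Lemma cabs_nat n : cabs n%:R = n%:R.
Proof. by rewrite -cart_nat cabs_real normr_nat. Qed.

Lemma cabsM z w : cabs (z * w) = cabs z * cabs w.
Proof. exact: Normc.normcM. Qed.

Lemma cabsV z : cabs z^-1 = (cabs z)^-1.
Proof. exact: Normc.normcV. Qed.

Lemma cabs_div z w : cabs (z / w) = cabs z / cabs w.
Proof. by rewrite cabsM cabsV. Qed.

Lemma cabsX z n : cabs (z ^+ n) = cabs z ^+ n.
Proof. by elim: n => [|n IH]; rewrite ?expr0 ?cabs1 // !exprS cabsM IH. Qed.

Lemma cabsD z w : cabs (z + w) <= cabs z + cabs w.
Proof. exact: le_normcD. Qed.

Lemma cabsN z : cabs (- z) = cabs z.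
Proof. exact: normcN. Qed.

Lemma cabsB z w : cabs (z - w) = cabs (w - z).
Proof. by rewrite -cabsN opprB. Qed.

Lemma cabs_sub z w : cabs (z - w) <= cabs z + cabs w.
Proof. by rewrite -(cabsN w) cabsD. Qed.

Lemma cabs_triangle u z w : cabs (z - w) <= cabs (z - u) + cabs (u - w).
Proof. by rewrite (_ : z - w = (z - u) + (u - w)) ?cabsD // addrA subrK. Qed.

Lemma cabs_sub_ge z w : cabs z - cabs w <= cabs (z - w).
Proof. by rewrite lerBlDr -{1}(subrK w z) cabsD. Qed.

Lemma cabs_eq0 z : (cabs z == 0) = (z == 0).
Proof.
apply/eqP/eqP => [/Normc.eq0_normc //|->]; exact: cabs0.
Qed.

Lemma cabs_gt0 z : (0 < cabs z) = (z != 0).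
Proof. by rewrite lt_def cabs_ge0 andbT cabs_eq0. Qed.

Lemma cabs_sqr z :
  cabs z ^+ 2 = (complex.Re z) ^+ 2 + (complex.Im z) ^+ 2.
Proof. by case: z => a b; rewrite sqr_sqrtr //= addr_ge0 // sqr_ge0. Qed.

Lemma Re_le_cabs z : `|complex.Re z| <= cabs z.
Proof.
rewrite -(@ler_pXn2r _ 2) ?nnegrE ?cabs_ge0 // cabs_sqr real_normK ?num_real //.
by rewrite lerDl sqr_ge0.
Qed.

Lemma Im_le_cabs z : `|complex.Im z| <= cabs z.
Proof.
rewrite -(@ler_pXn2r _ 2) ?nnegrE ?cabs_ge0 // cabs_sqr real_normK ?num_real //.
by rewrite lerDr sqr_ge0.
Qed.

Lemma cabs_le_ReIm z : cabs z <= `|complex.Re z| + `|complex.Im z|.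
Proof.
rewrite -(@ler_pXn2r _ 2) ?nnegrE ?cabs_ge0 ?addr_ge0 //.
rewrite cabs_sqr sqrrD !real_normK ?num_real // [leRHS]addrAC lerDl.
by rewrite mulrn_wge0 // mulr_ge0.
Qed.

Lemma cnbhsP z (A : set C) :
  nbhs z A <-> exists2 d : R, 0 < d & forall w, cabs (w - z) < d -> A w.
Proof.
split.
  move=> /nbhs_ballP[[d di] /=]; rewrite ltcE /= => /andP[/eqP -> d0] dA.
  exists d => // w wd; apply: dA; rewrite -ball_normE /ball_ /=.
  by rewrite cabsE ltcE /= eqxx /= cabsB.
move=> [d d0 dA]; apply/nbhs_ballP; exists (cart d 0).
  by rewrite /= ltcE /= eqxx.
move=> w; rewrite -ball_normE /ball_ /= cabsE ltcE /= eqxx /= cabsB => ?.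
exact: dA.
Qed.

Lemma cvg_cabsP (T : Type) (F : set_system T) (FF : Filter F) (f : T -> C) (l : C) :
  f @ F --> l <-> forall e : R, 0 < e -> \forall t \near F, cabs (f t - l) < e.
Proof.
split=> [fl e e0|fl A /cnbhsP[d d0 dA]].
  by apply: (fl [set w | cabs (w - l) < e]); apply/cnbhsP; exists e.
by apply: filterS (fl _ d0) => t /dA.
Qed.

Section Continuity.
Context {T : topologicalType}.
Implicit Types (f g : T -> C) (t : T).

Lemma ccontM f g t : {for t, continuous f} -> {for t, continuous g} ->
  {for t, continuous (fun s => f s * g s)}.
Proof. by move=> fc gc; exact: (@cvgM C T (nbhs t) _ f g _ _ fc gc). Qed.

Lemma ccontD f g t : {for t, continuous f} -> {for t, continuous g} ->
  {for t, continuous (fun s => f s + g s)}.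
Proof. by move=> fc gc; exact: (@cvgD C C T (nbhs t) _ f g _ _ fc gc). Qed.

Lemma ccontB f g t : {for t, continuous f} -> {for t, continuous g} ->
  {for t, continuous (fun s => f s - g s)}.
Proof. by move=> fc gc; exact: (@cvgB C C T (nbhs t) _ f g _ _ fc gc). Qed.

Lemma ccontV f t : f t != 0 -> {for t, continuous f} ->
  {for t, continuous (fun s => (f s)^-1)}.
Proof. by move=> f0 fc; exact: (@cvgV C T (nbhs t) _ f _ f0 fc). Qed.

Lemma ccont_cst c t : {for t, continuous (fun _ : T => c : C)}.
Proof. exact: cvg_cst. Qed.

End Continuity.

Lemma ccont_id z : {for z, continuous (fun w : C => w)}.
Proof. exact: cvg_id. Qed.

End Plane.

(** * Complex derivatives *)

Section ComplexDerivative.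
Context {R : realType}.
Local Notation C := (Cplx R).
Implicit Types (f g phi : C -> C) (z w l : C).

(** Caratheodory's form of differentiability: the difference quotient extends
    continuously to [z].  The rules for products, composites and inverses
    become statements about continuous functions. *)
Definition has_cderiv f z l := exists phi,
  [/\ {for z, continuous phi}, phi z = l &
      forall w, f w - f z = phi w * (w - z)].

Lemma continuous_cabsP f z : {for z, continuous f} <->
  forall e : R, 0 < e -> exists2 d : R, 0 < d &
    forall w, cabs (w - z) < d -> cabs (f w - f z) < e.
Proof.
rewrite /prop_for /continuous_at (cvg_cabsP (nbhs_filter z)).
by split=> H e /H /cnbhsP.
Qed.

Lemma has_cderivP f z l : has_cderiv f z l <->
  forall e : R, 0 < e -> exists2 d : R, 0 < d & forall w, cabs (w - z) < d ->
    cabs (f w - f z - l * (w - z)) <= e * cabs (w - z).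
Proof.
split.
  move=> [phi [/continuous_cabsP phic <- fE]] e /phic [d d0 H].
  exists d => // w /H/ltW wd; rewrite fE -mulrBl cabsM.
  by rewrite ler_wpM2r // cabs_ge0.
move=> H; pose phi w := if w == z then l else (f w - f z) / (w - z).
exists phi; split.
- apply/continuous_cabsP => e e0; have [|d d0 dH] := H (e / 2).
    by rewrite divr_gt0.
  exists d => // w wd; rewrite /phi eqxx; case: eqVneq => [_|wz].
    by rewrite subrr cabs0.
  have wz0 : w - z != 0 by rewrite subr_eq0.
  rewrite -(mulfK wz0 l) -mulrBl cabs_div ltr_pdivrMr ?cabs_gt0 //.
  rewrite (le_lt_trans (dH _ wd)) // ltr_pM2r ?cabs_gt0 //; lra.
- by rewrite /phi eqxx.
- move=> w; rewrite /phi; case: eqVneq => [->|wz]; first by rewrite !subrr mulr0.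
  by rewrite divfK // subr_eq0.
Qed.

Lemma has_cderiv_near f z l phi : {for z, continuous phi} -> phi z = l ->
  (\forall w \near z, f w - f z = phi w * (w - z)) -> has_cderiv f z l.
Proof.
move=> /continuous_cabsP phic <- /cnbhsP[d' d'0 fE].
apply/has_cderivP => e /phic [d d0 dH].
exists (Num.min d d'); first by rewrite lt_min d0 d'0.
move=> w; rewrite lt_min => /andP[wd wd']; rewrite fE // -mulrBl cabsM.
by rewrite ler_wpM2r ?cabs_ge0 // ltW // dH.
Qed.

Lemma has_cderiv_continuous f z l : has_cderiv f z l -> {for z, continuous f}.
Proof.
move=> [phi [phic _ fE]].
rewrite (_ : f = fun w => phi w * (w - z) + f z); last first.
  by apply/funext => w; rewrite -fE subrK.
apply: ccontD; last exact: ccont_cst.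
apply: ccontM; first exact: phic.
apply: ccontB; first exact: ccont_id.
exact: ccont_cst.
Qed.

Lemma has_cderiv_ext f g z l : (\forall w \near z, f w = g w) ->
  has_cderiv f z l -> has_cderiv g z l.
Proof.
move=> fg [phi [phic phil fE]]; apply: (has_cderiv_near phic phil).
have fgz := nbhs_singleton fg.
by apply: filterS fg => w <-; rewrite -fgz.
Qed.

Lemma has_cderiv_cst c z : has_cderiv (fun=> c) z 0.
Proof.
exists (fun=> 0); split; [exact: ccont_cst| by []|move=> w].
by rewrite subrr mul0r.
Qed.

Lemma has_cderiv_id z : has_cderiv (fun w => w) z 1.
Proof.
exists (fun=> 1); split; [exact: ccont_cst| by []|move=> w].
by rewrite mul1r.
Qed.

Lemma has_cderivD f g z l m : has_cderiv f z l -> has_cderiv g z m ->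
  has_cderiv (fun w => f w + g w) z (l + m).
Proof.
move=> [phi [phic <- fE]] [psi [psic <- gE]].
exists (fun w => phi w + psi w); split; [exact: (ccontD phic psic)| by []|move=> w].
by rewrite mulrDl -fE -gE; ring.
Qed.

Lemma has_cderivM f g z l m : has_cderiv f z l -> has_cderiv g z m ->
  has_cderiv (fun w => f w * g w) z (l * g z + f z * m).
Proof.
move=> df [psi [psic <- gE]]; have fc := has_cderiv_continuous df.
case: df => phi [phic <- fE].
exists (fun w => phi w * g z + f w * psi w); split; [|by []|move=> w].
  apply: ccontD; apply: ccontM;
    [exact: phic|exact: ccont_cst|exact: fc|exact: psic].
rewrite mulrDl mulrAC -fE -mulrA -gE; ring.
Qed.

Lemma has_cderiv_comp f g z l m : has_cderiv f z l -> has_cderiv g (f z) m ->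
  has_cderiv (fun w => g (f w)) z (m * l).
Proof.
move=> df [psi [psic <- gE]]; have fc := has_cderiv_continuous df.
case: df => phi [phic <- fE].
exists (fun w => psi (f w) * phi w); split; [|by []|move=> w].
  apply: ccontM; last exact: phic.
  exact: (continuous_comp fc psic).
by rewrite gE fE mulrA.
Qed.

Lemma has_cderiv_inv z : z != 0 -> has_cderiv (fun w => w^-1) z (- (z ^- 2)).
Proof.
move=> z0; apply: (@has_cderiv_near _ _ _ (fun w => (- z^-1) * w^-1)).
- apply: ccontM; first exact: ccont_cst.
  by apply: ccontV => //; exact: ccont_id.
- by rewrite mulNr -expr2 exprVn.
- apply/cnbhsP; exists (cabs z); first by rewrite cabs_gt0.
  move=> w wz; have w0 : w != 0.
    by apply/eqP => w0; move: wz; rewrite w0 sub0r cabsN ltxx.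
  by field; apply/andP.
Qed.

Lemma has_cderiv_unique f z l m :
  has_cderiv f z l -> has_cderiv f z m -> l = m.
Proof.
move=> /has_cderivP fl /has_cderivP fm.
apply/eqP; rewrite -subr_eq0 -cabs_eq0; apply/eqP/le_anti.
rewrite cabs_ge0 andbT; apply/ler_addgt0Pr => e e0; rewrite add0r.
have e20 : 0 < e / 2 by rewrite divr_gt0.
have [d d0 dH] := fl _ e20; have [d' d'0 dH'] := fm _ e20.
have D0 : 0 < Num.min d d' by rewrite lt_min d0 d'0.
pose t := Num.min d d' / 2.
have t0 : 0 < t by rewrite divr_gt0.
have tw : z + cart t 0 - z = cart t 0 by rewrite addrAC subrr add0r.
have ct : cabs (cart t 0 : C) = t by rewrite cabs_real gtr0_norm.
have : t < Num.min d d' by rewrite /t ltr_pdivrMr // mulr_natr mulr2n ltrDl.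
rewrite lt_min => /andP[td td'].
have := dH (z + cart t 0); have := dH' (z + cart t 0).
rewrite tw ct => /(_ td') A /(_ td) B.
rewrite -(ler_pM2r t0) -{1}ct -cabsM.
set F := f _ - f _ in A B.
have -> : (l - m) * cart t 0 = (F - m * cart t 0) - (F - l * cart t 0) by ring.
by rewrite (le_trans (cabs_sub _ _)) // (le_trans (lerD A B)) // -mulrDl -splitr.
Qed.

(** The difference quotient of [g] at [w] is the reciprocal of that of [f]
    along [g], so continuity of [g] is enough to pass to the limit. *)
Lemma has_cderiv_inverse f g w l :
  {for w, continuous g} -> (\forall v \near w, f (g v) = v) ->
  has_cderiv f (g w) l -> l != 0 -> has_cderiv g w l^-1.
Proof.
move=> gc fgK [phi [phic <- fE]] l0.
have fgw := nbhs_singleton fgK.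
have pgc : {for w, continuous (fun v => phi (g v))}.
  exact: (continuous_comp gc phic).
apply: (@has_cderiv_near _ _ _ (fun v => (phi (g v))^-1)); [|by []|].
  exact: (ccontV l0 pgc).
have pg0 : \forall v \near w, phi (g v) != 0.
  move/continuous_cabsP: pgc => /(_ (cabs (phi (g w)))).
  rewrite cabs_gt0 => /(_ l0) [d d0 H]; apply/cnbhsP; exists d => // v /H.
  by apply: contraTneq => ->; rewrite sub0r cabsN ltxx.
apply: filterS2 fgK pg0 => v fgv pv.
by apply: (mulfI pv); rewrite mulrA divff // mul1r -fE fgv fgw.
Qed.

Lemma derivableE f z :
  derivable f z 1 = cvg ((fun h : C => h^-1 *: (f (h + z) - f z)) @ 0^').
Proof.
rewrite /derivable (_ : (fun h => _) = fun h : C => h^-1 *: (f (h + z) - f z)) //.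
by apply/funext => h; rewrite /comp /shift /GRing.scale /= mulr1.
Qed.

Lemma derivable_has_cderiv f z : derivable f z 1 -> has_cderiv f z (derive1 f z).
Proof.
rewrite derivableE /derive1; set q := fun h => _; move=> qc.
apply/has_cderivP => e e0.
have /cvg_cabsP /(_ e e0) : q @ 0^' --> lim (q @ 0^') by exact: qc.
rewrite near_withinE => /cnbhsP[d d0 H].
exists d => // w wd; case: (eqVneq w z) => [->|wz].
  by rewrite !subrr mulr0 subrr !cabs0 mulr0.
have wz0 : w - z != 0 by rewrite subr_eq0.
have := H (w - z); rewrite subr0 => /(_ wd wz0) /ltW.
rewrite -(ler_pM2r (x := cabs (w - z))) ?cabs_gt0 // -cabsM.
by rewrite mulrBl /q subrK /GRing.scale /= mulrAC mulVf // mul1r.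
Qed.

Lemma has_cderiv_is_derive f z l : has_cderiv f z l ->
  derivable f z 1 /\ derive1 f z = l.
Proof.
move=> [phi [phic <- fE]].
have H : (fun h => h^-1 *: (f (h + z) - f z)) @ 0^' --> phi z.
  apply/cvg_cabsP => e e0; rewrite near_withinE.
  move/continuous_cabsP: phic => /(_ e e0) [d d0 dH].
  apply/cnbhsP; exists d => // h; rewrite subr0 => hd h0.
  rewrite fE addrK /GRing.scale /= mulrC -mulrA divff // mulr1.
  by apply: dH; rewrite addrK.
by rewrite derivableE; split; [exact: cvgP H|exact: cvg_lim H].
Qed.

End ComplexDerivative.

(** * Exponential and logarithm *)

Section ComplexExponential.
Context {R : realType}.
Local Notation C := (Cplx R).
Implicit Types (x y e : R) (z w : C).

Lemma ReB z w : complex.Re (z - w) = complex.Re z - complex.Re w.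
Proof. by case: z w => [a b] [c d]. Qed.

Lemma ImB z w : complex.Im (z - w) = complex.Im z - complex.Im w.
Proof. by case: z w => [a b] [c d]. Qed.

Definition cexp z : C :=
  cart (expR (complex.Re z) * cos (complex.Im z))
       (expR (complex.Re z) * sin (complex.Im z)).

Lemma cexpD z w : cexp (z + w) = cexp z * cexp w.
Proof.
case: z w => [a b] [c d]; rewrite /cexp /= cartM expRD cosD sinD.
by congr cart; ring.
Qed.

Lemma cexp0 : cexp 0 = 1.
Proof. by rewrite /cexp /= expR0 cos0 sin0 mulr1 mulr0. Qed.

Lemma cexpNM z : cexp (- z) * cexp z = 1.
Proof. by rewrite -cexpD addNr cexp0. Qed.

Lemma cabs_cexp z : cabs (cexp z) = expR (complex.Re z).
Proof.
rewrite cabs_cart !exprMn -mulrDr cos2Dsin2 mulr1 sqrtr_sqr.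
by rewrite gtr0_norm // expR_gt0.
Qed.

Lemma cexp_neq0 z : cexp z != 0.
Proof. by rewrite -cabs_gt0 cabs_cexp expR_gt0. Qed.

Lemma cexpN z : cexp (- z) = (cexp z)^-1.
Proof. by apply: (mulIf (cexp_neq0 z)); rewrite cexpNM mulVf // cexp_neq0. Qed.

Lemma cexp_2pi z : cexp (z + cart 0 (pi *+ 2)) = cexp z.
Proof. by rewrite cexpD {2}/cexp /= expR0 cos2pi sin2pi mulr1 mulr0 mulr1. Qed.

Lemma cexp_2pi_int (k : int) : cexp (cart 0 (pi *+ 2) *~ k) = 1.
Proof.
have H n : cexp (cart 0 (pi *+ 2) *+ n) = 1.
  by elim: n => [|n IH]; rewrite ?mulr0n ?cexp0 // mulrS addrC cexp_2pi.
by case: k => n; rewrite ?NegzE ?mulrNz -?pmulrn ?cexpN H ?invr1.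
Qed.

Lemma is_derive_littleo (f : R -> R) x l : is_derive x 1 f l ->
  forall e : R, 0 < e -> exists2 d : R, 0 < d & forall t, `|t - x| < d ->
    `|f t - f x - l * (t - x)| <= e * `|t - x|.
Proof.
move=> /is_derive1_caratheodory [g [fE gc <-]] e e0.
have : g @ x --> g x by exact: gc.
move/cvgrPdist_lt => /(_ e e0) /nbhs_ballP [d /= d0 H].
exists d => // t td; rewrite fE -mulrBl normrM ler_wpM2r // ltW //.
by rewrite distrC; apply: H; rewrite /ball /= distrC.
Qed.

(** Both coordinates of [cexp] are expanded to first order with the real
    derivatives of [expR], [cos] and [sin]. *)
Lemma has_cderiv_cexp0 : has_cderiv cexp 0 1.
Proof.
apply/has_cderivP => e e0.
(* The errors below add up to [9 * e' * n]. *)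
pose e' := e / 9; have e'0 : 0 < e' by rewrite /e' divr_gt0.
have [a a0 aH] := is_derive_littleo (@is_derive_expR R 0) e'0.
have [b b0 bH] := is_derive_littleo (is_derive_cos (0 : R)) e'0.
have [c c0 cH] := is_derive_littleo (is_derive_sin (0 : R)) e'0.
have [a1 a10 a1H] := is_derive_littleo (@is_derive_expR R 0) (@ltr01 R).
pose m := Num.min (Num.min a b) (Num.min c (Num.min a1 (Num.min e' 1))).
exists m => [|w]; first by rewrite /m !lt_min a0 b0 c0 a10 e'0 /=.
rewrite cexp0 subr0 mul1r !lt_min => /andP[/andP[wa wb] /and4P[wc wa1 we w1]].
have rw := Re_le_cabs w; have iw := Im_le_cabs w.
move: w wa wb wc wa1 we w1 rw iw => [x y]; set n := cabs _.
move=> na nb nc na1 ne n1 xn yn; rewrite /= in xn yn.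
have := aH x; have := bH y; have := cH y; have := a1H x.
rewrite !subr0 => /(_ (le_lt_trans xn na1)) A1 /(_ (le_lt_trans yn nc)) Hc.
move=> /(_ (le_lt_trans yn nb)) Hb /(_ (le_lt_trans xn na)) Ha.
move: A1 Hc Hb Ha; rewrite expR0 cos0 sin0 !oppr0 mul0r !mul1r subr0 !addr0.
move=> A1 Hc Hb Ha.
have n0 : 0 <= n by exact: cabs_ge0.
have E1 : `|expR x - 1| <= 2 * n.
  have := ler_normD (expR x - 1 - x) x; rewrite subrK; lra.
have E3 : `|expR x| <= 3.
  have := ler_normD (expR x - 1) 1; rewrite subrK normr1; lra.
have -> : cexp (x +i* y)%C - 1 - (x +i* y)%C =
    cart (expR x * cos y - 1 - x) (expR x * sin y - 0 - y) by [].
rewrite (le_trans (cabs_le_ReIm _)) //= subr0.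
have e'e : e = e' * 9 by rewrite /e' divfK.
have ExB : `|expR x * (cos y - 1)| <= 3 * (e' * n).
  rewrite normrM ler_pM //; apply: le_trans Hb _.
  by rewrite ler_wpM2l // ltW.
have ExC : `|expR x * (sin y - y)| <= 3 * (e' * n).
  rewrite normrM ler_pM //; apply: le_trans Hc _.
  by rewrite ler_wpM2l // ltW.
have ExD : `|(expR x - 1) * y| <= 2 * (e' * n).
  rewrite normrM (le_trans (ler_pM _ _ E1 yn)) // -mulrA ler_wpM2l //.
  by rewrite ler_wpM2r // ltW.
have Ha' : `|expR x - 1 - x| <= e' * n.
  by apply: le_trans Ha _; rewrite ler_wpM2l // ltW.
rewrite (_ : expR x * cos y - 1 - x =
  (expR x - 1 - x) + expR x * (cos y - 1)); last by ring.
rewrite (_ : expR x * sin y - y =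
  expR x * (sin y - y) + (expR x - 1) * y); last by ring.
have := ler_normD (expR x - 1 - x) (expR x * (cos y - 1)).
have := ler_normD (expR x * (sin y - y)) ((expR x - 1) * y).
rewrite e'e -/n; set p := `|_ + _|; set q := `|_ + _|; lra.
Qed.

Lemma has_cderiv_cexp z : has_cderiv cexp z (cexp z).
Proof.
have sh : has_cderiv (fun w => w - z) z 1.
  rewrite -[1]addr0; apply: has_cderivD; first exact: has_cderiv_id.
  exact: has_cderiv_cst.
have : has_cderiv (fun w => cexp (w - z)) z (1 * 1).
  apply: (has_cderiv_comp sh); rewrite subrr; exact: has_cderiv_cexp0.
move/(has_cderivM (has_cderiv_cst (cexp z) z)).
rewrite mul0r add0r !mulr1; apply: has_cderiv_ext.
by apply/cnbhsP; exists 1 => // w _; rewrite -cexpD addrC subrK.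
Qed.

(** The branch of the logarithm on the right half-plane. *)
Definition clog z : C :=
  cart (ln (cabs z)) (atan (complex.Im z / complex.Re z)).

Lemma sin_atan x : sin (atan x) = x * cos (atan x).
Proof.
have c0 : cos (atan x) != 0 by rewrite gt_eqF // cos_gt0_pihalf // atan_gtNpi2 atan_ltpi2.
by rewrite -{2}(atanK x) /tan divfK.
Qed.

Lemma clogK z : 0 < complex.Re z -> cexp (clog z) = z.
Proof.
case: z => x y /= x0; rewrite /cexp /clog /=.
have xy0 : 0 < Num.sqrt (x ^+ 2 + y ^+ 2).
  by rewrite sqrtr_gt0 ltr_pwDl ?sqr_ge0 // exprn_gt0.
have E : Num.sqrt (x ^+ 2 + y ^+ 2) = x * Num.sqrt (1 + (y / x) ^+ 2).
  transitivity (Num.sqrt (x ^+ 2) * Num.sqrt (1 + (y / x) ^+ 2)); last first.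
    by rewrite sqrtr_sqr gtr0_norm.
  rewrite -sqrtrM ?sqr_ge0 //.
  by congr Num.sqrt; field; rewrite gt_eqF.
have s0 : Num.sqrt (1 + (y / x) ^+ 2) != 0.
  by rewrite gt_eqF // sqrtr_gt0 ltr_pwDl ?sqr_ge0.
rewrite lnK ?posrE // sin_atan cos_atan E /cart.
by congr (_ +i* _)%C; field; rewrite ?s0 ?gt_eqF.
Qed.

Lemma clog1 : clog 1 = 0.
Proof. by rewrite /clog cabs1 /= ln1 mul0r atan0. Qed.

Lemma cvg_cart (T : Type) (F : set_system T) (FF : Filter F) (f g : T -> R) a b :
  f @ F --> a -> g @ F --> b -> (fun t => cart (f t) (g t)) @ F --> cart a b.
Proof.
move=> fa gb; apply/cvg_cabsP => e e0; have e20 : 0 < e / 2 by rewrite divr_gt0.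
move/cvgrPdist_lt: fa => /(_ _ e20) fa; move/cvgrPdist_lt: gb => /(_ _ e20) gb.
apply: filterS2 fa gb => t fa gb; rewrite cartB.
rewrite (le_lt_trans (cabs_le_ReIm _)) //= distrC [`|g t - _|]distrC.
by rewrite [e]splitr ltrD.
Qed.

Lemma Re_continuous z : {for z, continuous (@complex.Re R : C -> R)}.
Proof.
apply/(cvgrPdist_lt (FF := nbhs_filter z)) => e e0; apply/cnbhsP; exists e => // w wz.
apply: le_lt_trans wz; rewrite cabsB; by rewrite -ReB; exact: Re_le_cabs.
Qed.

Lemma Im_continuous z : {for z, continuous (@complex.Im R : C -> R)}.
Proof.
apply/(cvgrPdist_lt (FF := nbhs_filter z)) => e e0; apply/cnbhsP; exists e => // w wz.
apply: le_lt_trans wz; rewrite cabsB; by rewrite -ImB; exact: Im_le_cabs.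
Qed.

Lemma cabs_continuous z : {for z, continuous (@cabs R)}.
Proof.
apply/(cvgrPdist_lt (FF := nbhs_filter z)) => e e0; apply/cnbhsP; exists e => // w wz.
apply: le_lt_trans wz; rewrite ler_norml.
have := cabs_sub_ge w z; have := cabs_sub_ge z w; rewrite (cabsB z w); lra.
Qed.

Lemma clog_continuous z : 0 < complex.Re z -> {for z, continuous clog}.
Proof.
move=> z0; apply: (@cvg_cart _ (nbhs z) _).
  apply: (@continuous_comp _ _ _ (@cabs R) (@ln R)); first exact: cabs_continuous.
  by apply: continuous_ln; rewrite (lt_le_trans z0) // (le_trans (ler_norm _)) // Re_le_cabs.
apply: (@continuous_comp _ _ _ (fun w : C => complex.Im w / complex.Re w) (@atan R)).
  apply: (@cvgM _ _ (nbhs z) _ (@complex.Im R) (fun w => (complex.Re w)^-1)).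
    exact: Im_continuous.
  apply: (@cvgV _ _ (nbhs z) _ (@complex.Re R)); first by rewrite gt_eqF.
  exact: Re_continuous.
exact: continuous_atan.
Qed.

Lemma has_cderiv_clog z : 0 < complex.Re z -> has_cderiv clog z z^-1.
Proof.
move=> z0; have zn : z != 0.
  by rewrite -cabs_gt0 (lt_le_trans z0) // (le_trans (ler_norm _)) // Re_le_cabs.
apply: (has_cderiv_inverse (clog_continuous z0) _ _ zn).
  apply/cnbhsP; exists (complex.Re z) => // w wz; apply: clogK.
  have := Re_le_cabs (w - z); rewrite ReB ler_norml; lra.
by rewrite -[X in has_cderiv _ _ X](clogK z0); exact: has_cderiv_cexp.
Qed.

(** Bounding the imaginary part keeps the size of a logarithm under control
    by the modulus alone; this is what makes Schottky's bound uniform. *)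
Lemma exists_log z : z != 0 -> exists l,
  [/\ cexp l = z, complex.Re l = ln (cabs z) & `|complex.Im l| <= pi].
Proof.
rewrite -cabs_gt0 => z0.
have [a aE] : exists a : R, [/\ cabs z * cos a = complex.Re z,
   cabs z * sin a = complex.Im z & `|a| <= pi].
  pose t := complex.Re z / cabs z.
  have t1 : -1 <= t <= 1.
    by rewrite -ler_norml normrM normfV (gtr0_norm z0) ler_pdivrMr // mul1r Re_le_cabs.
  have ct : cabs z * cos (acos t) = complex.Re z.
    by rewrite acosK ?in_itv //= mulrC /t divfK // gt_eqF.
  have st : cabs z * sin (acos t) = `|complex.Im z|.
    rewrite sin_acos //.
    transitivity (Num.sqrt (cabs z ^+ 2) * Num.sqrt (1 - t ^+ 2)).
      by rewrite sqrtr_sqr gtr0_norm.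
    rewrite -sqrtrM ?sqr_ge0 // -sqrtr_sqr; congr Num.sqrt.
    rewrite mulrBr mulr1 -exprMn mulrC /t.
    by rewrite divfK ?gt_eqF // cabs_sqr addrAC subrr add0r.
  have ap : `|acos t| <= pi by rewrite ger0_norm ?acos_ge0 ?acos_lepi.
  case: (lerP 0 (complex.Im z)) => iz.
    by exists (acos t); rewrite st ger0_norm.
  by exists (- acos t); rewrite cosN sinN mulrN st normrN ltr0_norm // opprK.
case: aE => ca sa ap; exists (cart (ln (cabs z)) a); split => //.
by rewrite /cexp /= lnK ?posrE // ca sa; case: z {z0 ca sa}.
Qed.

End ComplexExponential.

(** * Subdivision of squares and compactness of discs *)

Section Subdivision.
Context {R : realType}.
Local Notation C := (Cplx R).
Implicit Types (x y l d : R) (z w : C).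

Lemma nested_intervals (a b : nat -> R) :
  (forall n, a n <= a n.+1) -> (forall n, b n.+1 <= b n) ->
  (forall n, a n <= b n) -> exists c, forall n, a n <= c <= b n.
Proof.
move=> a_inc b_dec ab.
have aM n m : a n <= a (n + m)%N.
  by elim: m => [|m IH]; rewrite ?addn0 // addnS (le_trans IH).
have bM n m : b (n + m)%N <= b n.
  by elim: m => [|m IH]; rewrite ?addn0 // addnS (le_trans _ IH).
have amb n m : a m <= b n.
  case: (leqP m n) => mn.
    by rewrite (le_trans (aM m (n - m)%N)) // subnKC.
  have := bM n (m - n)%N; rewrite subnKC 1?ltnW //; apply: le_trans.
  exact: ab.
have ub : has_ubound (range a) by exists (b 0%N) => _ [m _ <-].
exists (sup (range a)) => n; apply/andP; split.
  by apply: ub_le_sup => //; exists n.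
by apply: ge_sup; [exists (a 0%N), 0%N|move=> _ [m _ <-]].
Qed.

Definition in_square x y l z :=
  x <= complex.Re z <= x + l /\ y <= complex.Im z <= y + l.

Lemma ltr_pow2 l d : 0 < d -> exists n, l / 2 ^+ n < d.
Proof.
move=> d0; exists (Num.bound (l / d)); rewrite ltr_pdivrMr ?exprn_gt0 //.
by rewrite mulrC -ltr_pdivrMr //; exact: upper_nthrootP.
Qed.

(** Cousin's lemma: if [P] failed on the square it would fail on one of its
    quarters, hence on a sequence of nested squares shrinking to a point
    near which [P] holds.  It serves both for Goursat's theorem and as a
    substitute for the compactness of closed discs. *)
Lemma square_subdivision (P : R -> R -> R -> Prop) x y l : 0 < l ->
  (forall x y l, 0 < l -> P x y l -> P (x + l) y l -> P x (y + l) l ->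
     P (x + l) (y + l) l -> P x y (l + l)) ->
  (forall z, in_square x y l z -> exists2 d : R, 0 < d &
     forall x' y' l', 0 < l' < d -> x <= x' -> x' + l' <= x + l ->
       y <= y' -> y' + l' <= y + l -> in_square x' y' l' z -> P x' y' l') ->
  P x y l.
Proof.
move=> l0 Pquad Ploc; apply: contrapT => nP.
have step (s : R * R * R) : exists s' : R * R * R,
    [/\ s'.2 = s.2 / 2, s.1.1 <= s'.1.1, s.1.2 <= s'.1.2,
        0 < s.2 -> s'.1.1 + s'.2 <= s.1.1 + s.2 /\ s'.1.2 + s'.2 <= s.1.2 + s.2 &
        0 < s.2 -> ~ P s.1.1 s.1.2 s.2 -> ~ P s'.1.1 s'.1.2 s'.2].
  case: s => [[a b] m] /=.
  have [m0|m0] := ltP 0 m; last by exists (a, b, m / 2).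
  apply: contrapT => no.
  have m20 : 0 < m / 2 by rewrite divr_gt0.
  have mm : m = m / 2 + m / 2 by rewrite -splitr.
  have Q a' b' : a <= a' <= a + m / 2 -> b <= b' <= b + m / 2 ->
      ~ P a b m -> P a' b' (m / 2).
    move=> /andP[a1 a2] /andP[b1 b2] nPm; apply: contrapT => nP'; apply: no.
    exists (a', b', m / 2); split=> //= _.
    by split; rewrite [in leRHS]mm addrA lerD2r.
  apply: no; exists (a, b, m / 2); split=> //=.
    by move=> _; split; rewrite lerD2l ler_pdivrMr // mulr_natr mulr2n lerDl ltW.
  move=> _ nPm _; apply: (nPm); rewrite mm; apply: Pquad => //; apply: Q => //;
    by rewrite ?lexx ?lerDl ltW.
have [nxt nxtP] := choice step.
pose S n := iter n nxt (x, y, l).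
have Sl n : (S n).2 = l / 2 ^+ n.
  elim: n => [|n IH]; first by rewrite expr0 divr1.
  by rewrite /S /= -/(S n); have [-> _ _ _ _] := nxtP (S n); rewrite IH exprS; field.
have Sl0 n : 0 < (S n).2 by rewrite Sl divr_gt0 // exprn_gt0.
have SnP n : ~ P (S n).1.1 (S n).1.2 (S n).2.
  elim: n => [//|n IH]; rewrite /S /= -/(S n).
  by have [_ _ _ _ H] := nxtP (S n); exact: H.
have a1 n : (S n).1.1 <= (S n.+1).1.1.
  by rewrite /S /= -/(S n); have [_ H _ _ _] := nxtP (S n).
have a2 n : (S n).1.2 <= (S n.+1).1.2.
  by rewrite /S /= -/(S n); have [_ _ H _ _] := nxtP (S n).
have b1 n : (S n.+1).1.1 + (S n.+1).2 <= (S n).1.1 + (S n).2.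
  by rewrite /S /= -/(S n); have [_ _ _ H _] := nxtP (S n); case: (H (Sl0 n)).
have b2 n : (S n.+1).1.2 + (S n.+1).2 <= (S n).1.2 + (S n).2.
  by rewrite /S /= -/(S n); have [_ _ _ H _] := nxtP (S n); case: (H (Sl0 n)).
have [|p pS] := nested_intervals a1 b1; first by move=> n; rewrite lerDl ltW.
have [|q qS] := nested_intervals a2 b2; first by move=> n; rewrite lerDl ltW.
have [|d d0 H] := Ploc (cart p q).
  by split; [exact: (pS 0%N)|exact: (qS 0%N)].
have mono n : [/\ x <= (S n).1.1, (S n).1.1 + (S n).2 <= x + l,
    y <= (S n).1.2 & (S n).1.2 + (S n).2 <= y + l].
  elim: n => [|n [h1 h2 h3 h4]]; first by split.
  by split; [exact: le_trans h1 _|exact: le_trans h2|exact: le_trans h3 _|exact: le_trans h4].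
have [n nd] := ltr_pow2 l d0; apply: (SnP n).
have [h1 h2 h3 h4] := mono n; apply: H => //.
by rewrite Sl0 Sl.
Qed.

(** A positive constant that works near each point of a closed disc can be
    chosen once and for all: the property of a square that one constant works
    for all of its points is inherited from the four quarters. *)
Lemma disc_uniform (Q : R -> C -> Prop) (r : R) : 0 < r ->
  (forall d d' z, 0 < d' <= d -> Q d z -> Q d' z) ->
  (forall z, cabs z <= r -> exists2 d : R, 0 < d &
     forall w, cabs (w - z) < d -> Q d w) ->
  exists2 d : R, 0 < d & forall z, cabs z <= r -> Q d z.
Proof.
move=> r0 Qmono Qloc.
suff [d d0 H] : exists2 d : R, 0 < d &
    forall z, in_square (- r) (- r) (r + r) z -> cabs z <= r -> Q d z.
  exists d => // z zr; apply: H => //.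
  have := Re_le_cabs z; have := Im_le_cabs z; rewrite !ler_norml.
  by move=> *; split; lra.
apply: (square_subdivision (P := fun x y l => exists2 d : R, 0 < d &
    forall z, in_square x y l z -> cabs z <= r -> Q d z)).
- by rewrite addr_gt0.
- move=> x y l l0 [a a0 A] [b b0 B] [c c0 C'] [d d0 D].
  pose m := Num.min (Num.min a b) (Num.min c d).
  have m0 : 0 < m by rewrite !lt_min a0 b0 c0 d0.
  have [[ma mb] [mc md]] : (m <= a /\ m <= b) /\ (m <= c /\ m <= d).
    by split; split; rewrite !ge_min lexx ?orbT.
  exists m => // z [zx zy] zr.
  have [zxl|zxl] := leP (complex.Re z) (x + l); have [zyl|zyl] := leP (complex.Im z) (y + l).
  + by apply: Qmono (A z _ zr); [rewrite m0|split; lra].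
  + by apply: Qmono (C' z _ zr); [rewrite m0|split; lra].
  + by apply: Qmono (B z _ zr); [rewrite m0|split; lra].
  + by apply: Qmono (D z _ zr); [rewrite m0|split; lra].
- move=> p _; have [pr|pr] := leP (cabs p) r.
    have [d d0 H] := Qloc p pr; exists (d / 2); first by rewrite divr_gt0.
    move=> x y l /andP[l0 ld] _ _ _ _ [px py]; exists d => // z [zx zy] _.
    apply: H; apply: le_lt_trans (cabs_le_ReIm _) _; rewrite ReB ImB.
    have : `|complex.Re z - complex.Re p| <= l by rewrite ler_norml; lra.
    have : `|complex.Im z - complex.Im p| <= l by rewrite ler_norml; lra.
    lra.
  exists ((cabs p - r) / 2); first by rewrite divr_gt0 // subr_gt0.
  move=> x y l /andP[l0 ld] _ _ _ _ [px py]; exists 1 => // z [zx zy] zr.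
  have := cabs_sub_ge p z; rewrite cabsB.
  have := cabs_le_ReIm (z - p); rewrite ReB ImB.
  have : `|complex.Re z - complex.Re p| <= l by rewrite ler_norml; lra.
  have : `|complex.Im z - complex.Im p| <= l by rewrite ler_norml; lra.
  lra.
Qed.

Lemma disc_bounded (f : C -> C) (r : R) : 0 < r ->
  (forall z, cabs z <= r -> {for z, continuous f}) ->
  exists2 M : R, 0 < M & forall z, cabs z <= r -> cabs (f z) <= M.
Proof.
move=> r0 fc.
have [d d' z /andP[d0 dd]|z zr|d d0 H] :=
    @disc_uniform (fun d z => cabs (f z) <= d^-1) r r0.
- move=> /le_trans; apply; rewrite lef_pV2 ?posrE //; exact: lt_le_trans dd.
- have /continuous_cabsP /(_ 1 ltr01) [d d0 H] := fc z zr.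
  have g0 : 0 < 1 + cabs (f z) by rewrite ltr_pwDl // cabs_ge0.
  exists (Num.min d (1 + cabs (f z))^-1); first by rewrite lt_min d0 invr_gt0.
  move=> w; rewrite lt_min => /andP[/H wz _].
  have m0 : 0 < Num.min d (1 + cabs (f z))^-1 by rewrite lt_min d0 invr_gt0.
  apply: (@le_trans _ _ (1 + cabs (f z))).
    by have := cabs_sub_ge (f w) (f z); lra.
  by rewrite -[leLHS]invrK lef_pV2 ?posrE ?invr_gt0 // ge_min lexx orbT.
- by exists d^-1; rewrite ?invr_gt0.
Qed.

End Subdivision.

(** * Complex integrals over segments *)

Section SegmentIntegral.
Context {R : realType}.
Local Notation C := (Cplx R).
Local Notation mu := (@lebesgue_measure R).
Implicit Types (a b c x y l s M : R) (g h : R -> C).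

Definition cont_segment a b g :=
  forall t, a <= t <= b -> {for t, continuous g}.

Definition cint g a b : C :=
  cart (\int[mu]_(t in `[a, b]) complex.Re (g t))
       (\int[mu]_(t in `[a, b]) complex.Im (g t)).

Lemma integrable_Re a b g : cont_segment a b g ->
  mu.-integrable `[a, b] (EFin \o (fun t => complex.Re (g t))).
Proof.
move=> gc; apply: continuous_compact_integrable; first exact: segment_compact.
apply: continuous_in_subspaceT => t; rewrite inE /= in_itv /= => /gc gt.
exact: (continuous_comp gt (@Re_continuous _ (g t))).
Qed.

Lemma integrable_Im a b g : cont_segment a b g ->
  mu.-integrable `[a, b] (EFin \o (fun t => complex.Im (g t))).
Proof.
move=> gc; apply: continuous_compact_integrable; first exact: segment_compact.
apply: continuous_in_subspaceT => t; rewrite inE /= in_itv /= => /gc gt.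
exact: (continuous_comp gt (@Im_continuous _ (g t))).
Qed.

Lemma eq_cint a b g h : (forall t, a <= t <= b -> g t = h t) ->
  cint g a b = cint h a b.
Proof.
move=> gh; congr cart; apply: eq_Rintegral => t; rewrite inE /= in_itv /=;
  by move=> /gh ->.
Qed.

Lemma cintB a b g h : cont_segment a b g -> cont_segment a b h ->
  cint (fun t => g t - h t) a b = cint g a b - cint h a b.
Proof.
move=> gc hc; rewrite cartB; congr cart.
  rewrite -RintegralB //; [|exact: integrable_Re|exact: integrable_Re].
  by apply: eq_Rintegral => t _; rewrite ReB.
rewrite -RintegralB //; [|exact: integrable_Im|exact: integrable_Im].
by apply: eq_Rintegral => t _; rewrite ImB.
Qed.

Lemma fine_itv a b : a <= b -> fine (mu `[a, b]) = b - a.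
Proof.
move=> ab; rewrite lebesgue_measure_itv /= lte_fin.
by case: ltgtP ab => // -> _; rewrite subrr.
Qed.

Lemma cint_cst a b z : a <= b -> cint (fun=> z) a b = z * cart (b - a) 0.
Proof.
move=> ab; rewrite /cint !Rintegral_cst //= fine_itv //.
by case: z => x y; rewrite -/(cart x y) cartM /=; congr cart; ring.
Qed.

Lemma Rint_bound a b M (f : R -> R) : a <= b ->
  mu.-integrable `[a, b] (EFin \o f) ->
  (forall t, a <= t <= b -> `|f t| <= M) ->
  `|\int[mu]_(t in `[a, b]) f t| <= M * (b - a).
Proof.
move=> ab fi fM; rewrite -(fine_itv ab) -(@Rintegral_cst _ _ _ mu) //.
apply: le_trans (le_normr_Rintegral _ _) _ => //.
have ci : mu.-integrable `[a, b] (EFin \o (fun=> M)).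
  apply: continuous_compact_integrable; first exact: segment_compact.
  by apply: continuous_subspaceT => t; exact: cst_continuous.
apply: le_Rintegral; [by []|exact: (integrable_norm fi)|exact: ci|].
by move=> t; rewrite /= in_itv /=; exact: fM.
Qed.

(** The factor 2 comes from treating the two coordinates separately.  It is
    harmless: only the existence of a universal constant matters in
    [cauchy_estimate]. *)
Lemma cint_bound a b M g : a <= b -> cont_segment a b g ->
  (forall t, a <= t <= b -> cabs (g t) <= M) ->
  cabs (cint g a b) <= 2 * M * (b - a).
Proof.
move=> ab gc gM; rewrite (le_trans (cabs_le_ReIm _)) //=.
rewrite -mulrA mulr_natl mulr2n; apply: lerD; apply: Rint_bound => //.
- exact: integrable_Re.
- by move=> t /gM; apply: le_trans; exact: Re_le_cabs.
- exact: integrable_Im.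
- by move=> t /gM; apply: le_trans; exact: Im_le_cabs.
Qed.

Lemma Rint_split a b c (f : R -> R) : a <= b -> b <= c ->
  mu.-integrable `[a, c] (EFin \o f) ->
  \int[mu]_(t in `[a, c]) f t =
  \int[mu]_(t in `[a, b]) f t + \int[mu]_(t in `[b, c]) f t.
Proof.
move=> ab bc fi; apply/eqP; rewrite addrC -subr_eq; apply/eqP.
rewrite Rintegral_itvB ?bnd_simp // Rintegral_itv_obnd_cbnd //.
apply: integrableS fi => //; apply: subset_itvr; rewrite bnd_simp //.
Qed.

Lemma cint_split a b c g : a <= b -> b <= c -> cont_segment a c g ->
  cint g a c = cint g a b + cint g b c.
Proof.
move=> ab bc gc; rewrite cartD; congr cart; apply: Rint_split => //.
  exact: integrable_Re.
exact: integrable_Im.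
Qed.

End SegmentIntegral.

(** * Goursat's theorem for squares *)

Section Goursat.
Context {R : realType}.
Local Notation C := (Cplx R).
Implicit Types (x y l s M : R) (F G : C -> C).

(** The contour integral along the boundary of a square, with the factor
    [cart 0 1] standing for the direction of the vertical sides. *)
Definition square_integral F x y l : C :=
  (cint (fun t => F (cart t y)) x (x + l) -
   cint (fun t => F (cart t (y + l))) x (x + l)) +
  cart 0 1 * (cint (fun t => F (cart (x + l) t)) y (y + l) -
              cint (fun t => F (cart x t)) y (y + l)).

Definition cont_square F x y l :=
  forall z, in_square x y l z -> {for z, continuous F}.

Lemma continuous_horizontal F y t : {for cart t y, continuous F} ->
  {for t, continuous (fun t => F (cart t y))}.
Proof.
move=> Fc.
have cc : {for t, continuous (fun t => cart t y : C)}.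
  by apply: (@cvg_cart _ _ (nbhs t) _); [exact: cvg_id|exact: cvg_cst].
exact: (continuous_comp cc Fc).
Qed.

Lemma continuous_vertical F x t : {for cart x t, continuous F} ->
  {for t, continuous (fun t => F (cart x t))}.
Proof.
move=> Fc.
have cc : {for t, continuous (fun t => cart x t : C)}.
  by apply: (@cvg_cart _ _ (nbhs t) _); [exact: cvg_cst|exact: cvg_id].
exact: (continuous_comp cc Fc).
Qed.

Lemma cont_horizontal F x y l y' : cont_square F x y l -> y <= y' <= y + l ->
  cont_segment x (x + l) (fun t => F (cart t y')).
Proof. by move=> Fc yy t xt; apply: continuous_horizontal; apply: Fc. Qed.

Lemma cont_vertical F x y l x' : cont_square F x y l -> x <= x' <= x + l ->
  cont_segment y (y + l) (fun t => F (cart x' t)).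
Proof. by move=> Fc xx t yt; apply: continuous_vertical; apply: Fc. Qed.

Lemma cont_square_sub F x y l x' y' l' :
  x <= x' -> x' + l' <= x + l -> y <= y' -> y' + l' <= y + l ->
  cont_square F x y l -> cont_square F x' y' l'.
Proof. by move=> ? ? ? ? Fc z [zx zy]; apply: Fc; split; lra. Qed.

Lemma square_integralB F G x y l : 0 <= l ->
  cont_square F x y l -> cont_square G x y l ->
  square_integral (fun z => F z - G z) x y l =
  square_integral F x y l - square_integral G x y l.
Proof.
move=> l0 Fc Gc.
have [hx hx' hy hy'] : [/\ x <= x <= x + l, x <= x + l <= x + l,
  y <= y <= y + l & y <= y + l <= y + l] by split; lra.
rewrite /square_integral (cintB (cont_horizontal Fc hy) (cont_horizontal Gc hy)).
rewrite (cintB (cont_horizontal Fc hy') (cont_horizontal Gc hy')).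
rewrite (cintB (cont_vertical Fc hx) (cont_vertical Gc hx)).
rewrite (cintB (cont_vertical Fc hx') (cont_vertical Gc hx')).
ring.
Qed.

Lemma square_integral_quarter F x y l : 0 <= l -> cont_square F x y (l + l) ->
  square_integral F x y (l + l) =
  square_integral F x y l + square_integral F (x + l) y l +
  square_integral F x (y + l) l + square_integral F (x + l) (y + l) l.
Proof.
move=> l0 Fc; rewrite /square_integral.
have sp y' : y <= y' <= y + (l + l) -> cint (fun t => F (cart t y')) x (x + (l + l)) =
    cint (fun t => F (cart t y')) x (x + l) +
    cint (fun t => F (cart t y')) (x + l) (x + l + l).
  move=> yy; rewrite addrA; apply: cint_split; rewrite ?lerDl //.
  by rewrite -addrA; exact: cont_horizontal Fc yy.
have sp' x' : x <= x' <= x + (l + l) -> cint (fun t => F (cart x' t)) y (y + (l + l)) =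
    cint (fun t => F (cart x' t)) y (y + l) +
    cint (fun t => F (cart x' t)) (y + l) (y + l + l).
  move=> xx; rewrite addrA; apply: cint_split; rewrite ?lerDl //.
  by rewrite -addrA; exact: cont_vertical Fc xx.
have [h1 h2 h3 h4] : [/\ y <= y <= y + (l + l), y <= y + (l + l) <= y + (l + l),
  x <= x <= x + (l + l) & x <= x + (l + l) <= x + (l + l)] by split; lra.
rewrite (sp _ h1) (sp _ h2) (sp' _ h3) (sp' _ h4).
rewrite !addrA; ring.
Qed.

Lemma continuous_affine (u v z : C) : {for z, continuous (fun z : C => u + v * z)}.
Proof.
apply: ccontD; first exact: ccont_cst.
by apply: ccontM; [exact: ccont_cst|exact: ccont_id].
Qed.

(** The integrands of opposite sides differ by a constant. *)
Lemma square_integral_affine (u v : C) x y l : 0 <= l ->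
  square_integral (fun z => u + v * z) x y l = 0.
Proof.
move=> l0; rewrite /square_integral.
have Ac := @continuous_affine u v.
rewrite -cintB; first last.
- by move=> t _; exact: (continuous_horizontal (Ac _)).
- by move=> t _; exact: (continuous_horizontal (Ac _)).
rewrite -cintB; first last.
- by move=> t _; exact: (continuous_vertical (Ac _)).
- by move=> t _; exact: (continuous_vertical (Ac _)).
rewrite (@eq_cint _ _ _ _ (fun=> - (v * cart 0 l))); last first.
  move=> t _; rewrite (_ : cart t (y + l) = cart t y + cart 0 l); first ring.
  by rewrite cartD addr0.
rewrite (@eq_cint _ y _ _ (fun=> v * cart l 0)); last first.
  move=> t _; rewrite (_ : cart (x + l) t = cart x t + cart l 0); first ring.
  by rewrite cartD addr0.
rewrite !cint_cst ?lerDl // !(addrC x) !(addrC y) !addrK.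
rewrite (_ : cart 0 l = cart 0 1 * cart l 0); last first.
  by rewrite cartM; congr cart; ring.
ring.
Qed.

Lemma square_integral_bound F x y l M : 0 <= l -> cont_square F x y l ->
  (forall z, in_square x y l z -> cabs (F z) <= M) ->
  cabs (square_integral F x y l) <= 8 * M * l.
Proof.
move=> l0 Fc FM.
have [hx hx' hy hy'] : [/\ x <= x <= x + l, x <= x + l <= x + l,
  y <= y <= y + l & y <= y + l <= y + l] by split; lra.
have H y' : y <= y' <= y + l -> cabs (cint (fun t => F (cart t y')) x (x + l)) <= 2 * M * l.
  move=> yy; rewrite [leRHS](_ : _ = 2 * M * (x + l - x)); last by ring.
  apply: cint_bound; rewrite ?lerDl //; first exact: cont_horizontal Fc yy.
  by move=> t xt; apply: FM.
have V x' : x <= x' <= x + l -> cabs (cint (fun t => F (cart x' t)) y (y + l)) <= 2 * M * l.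
  move=> xx; rewrite [leRHS](_ : _ = 2 * M * (y + l - y)); last by ring.
  apply: cint_bound; rewrite ?lerDl //; first exact: cont_vertical Fc xx.
  by move=> t yt; apply: FM.
have i1 : cabs (cart 0 1 : C) = 1 by rewrite cabs_cart expr0n expr1n add0r sqrtr1.
rewrite /square_integral (le_trans (cabsD _ _)) // cabsM i1 mul1r.
have := H _ hy; have := H _ hy'; have := V _ hx; have := V _ hx'.
set p := cint _ _ _; set q := cint _ _ _; set r := cint _ _ _; set s := cint _ _ _.
have := cabs_sub s r; have := cabs_sub p q; lra.
Qed.

(** Goursat's argument.  The integral is additive under subdivision, and near
    a point where [F] is differentiable [F] may be replaced by its affine
    approximation, whose integral vanishes, at the cost of an error that is
    small with respect to the area; so the integral is smaller than any
    multiple of the area. *)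
Lemma goursat_square F x y l : 0 < l ->
  (forall z, in_square x y l z -> exists d, has_cderiv F z d) ->
  square_integral F x y l = 0.
Proof.
move=> l0 Fd.
have Fcont : cont_square F x y l.
  by move=> z /Fd[d /has_cderiv_continuous].
apply/eqP; rewrite -cabs_eq0; apply/eqP/le_anti; rewrite cabs_ge0 andbT.
apply/ler_addgt0Pr => e e0; rewrite add0r.
(* The bound [e] is spread over the square in proportion to the area. *)
pose e1 := e / l ^+ 2.
have e10 : 0 < e1 by rewrite divr_gt0 // exprn_gt0.
rewrite -[e](divfK (x := l ^+ 2)) ?gt_eqF ?exprn_gt0 // -/e1.
move: (Fcont); apply: (square_subdivision (P := fun x y l => cont_square F x y l ->
   cabs (square_integral F x y l) <= e1 * l ^+ 2)) => //.
- move=> x' y' m m0 A B C' D Fc; rewrite (square_integral_quarter (ltW m0) Fc).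
  have m0' := ltW m0.
  have sub x1 y1 : x' <= x1 -> x1 <= x' + m -> y' <= y1 -> y1 <= y' + m ->
      cont_square F x1 y1 m.
    by move=> ? ? ? ?; apply: cont_square_sub Fc; rewrite // addrA lerD2r.
  have lx : x' <= x' + m by rewrite lerDl.
  have ly : y' <= y' + m by rewrite lerDl.
  apply: le_trans (cabsD _ _) _; apply: le_trans (lerD (cabsD _ _) (lexx _)) _.
  apply: le_trans (lerD (lerD (cabsD _ _) (lexx _)) (lexx _)) _.
  rewrite [leRHS](_ : _ = e1 * m ^+ 2 + e1 * m ^+ 2 + e1 * m ^+ 2 + e1 * m ^+ 2);
    last by ring.
  apply: lerD; [apply: lerD; [apply: lerD|]|].
  + by apply: A; apply: sub.
  + by apply: B; apply: sub.
  + by apply: C'; apply: sub.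
  + by apply: D; apply: sub.
- move=> p pin; have [d Fp] := Fd p pin.
  (* The diameter is at most twice the side and the integral is at most
     [8 * sup * side]: hence the 16. *)
  have e160 : 0 < e1 / 16 by rewrite divr_gt0.
  move/has_cderivP: Fp => /(_ _ e160) [r r0 H].
  exists (r / 2); first by rewrite divr_gt0.
  move=> x' y' m /andP[m0 mr] _ _ _ _ [px py] Fc.
  pose A z := (F p - d * p) + d * z.
  have Ac : cont_square A x' y' m.
    by move=> z _; exact: continuous_affine.
  have := square_integralB (ltW m0) Fc Ac.
  rewrite [X in _ = _ - X](square_integral_affine _ _ _ _ (ltW m0)) subr0 => <-.
  have -> : e1 * m ^+ 2 = 8 * (e1 / 16 * (2 * m)) * m by field.
  apply: square_integral_bound; first exact: ltW.
    move=> z zin; exact: (ccontB (Fc z zin) (Ac z zin)).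
  move=> z [zx zy].
  have zp : cabs (z - p) <= 2 * m.
    apply: le_trans (cabs_le_ReIm _) _; rewrite ReB ImB mulr_natl mulr2n.
    by apply: lerD; rewrite ler_norml; lra.
  have zr : cabs (z - p) < r by apply: le_lt_trans zp _; lra.
  rewrite (_ : F z - A z = F z - F p - d * (z - p)); last by rewrite /A; ring.
  by apply: le_trans (H z zr) _; rewrite ler_wpM2l // ltW.
Qed.

End Goursat.

(** * Cauchy's estimate *)

Section CauchyEstimate.
Context {R : realType}.
Local Notation C := (Cplx R).
Implicit Types (s e r M : R) (f : C -> C) (a z l : C).

Definition hol (a : C) r f := forall z, cabs (z - a) < r -> exists l, has_cderiv f z l.

(** In the coordinate [z = exp s] the circles around 0 become vertical segments
    of length [2 pi], and the function [(f z - f 0) / z] becomes periodic of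
    period [2 pi i].  On a square of side [2 pi] the horizontal sides then
    contribute nothing, so Goursat's theorem says that the mean of
    [(f z - f 0) / z] is the same on the circles of radius [r] and
    [exp (- 2 pi) r].  Going to the centre, this mean is [f' 0]; on the circle
    of radius [exp (- 1)] it is at most a constant times the bound of [f]. *)
Lemma cauchy_estimate_unit f M l : hol 0 1 f ->
  (forall z, cabs z < 1 -> cabs (f z) <= M) ->
  has_cderiv f 0 l -> cabs l <= 4 * expR 1 * M.
Proof.
move=> fh fM fl.
pose F z := (f (cexp z) - f 0) * cexp (- z).
have cexp_lt1 z : complex.Re z < 0 -> cabs (cexp z) < 1.
  by move=> z0; rewrite cabs_cexp expR_lt1.
have Fd z : complex.Re z < 0 -> exists d, has_cderiv F z d.
  move=> /cexp_lt1 z1; have [|d dP] := fh (cexp z); first by rewrite subr0.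
  have d1 := has_cderiv_comp (has_cderiv_cexp z) dP.
  have d2 := has_cderivD d1 (has_cderiv_cst (- f 0) z).
  have d3 : has_cderiv (fun w => - 1 * w) z (0 * z + (-1) * 1).
    exact: (has_cderivM (has_cderiv_cst _ _) (has_cderiv_id z)).
  have d4 := has_cderiv_comp d3 (has_cderiv_cexp _).
  have := has_cderivM d2 d4; set m := (_ + _); move=> H; exists m.
  apply: has_cderiv_ext H; apply/cnbhsP; exists 1 => // w _.
  by rewrite mulN1r.
have Fper t : F (cart t (0 + pi *+ 2)) = F (cart t 0).
  have E : cart t (0 + pi *+ 2) = cart t 0 + cart 0 (pi *+ 2).
    by rewrite cartD addr0.
  have cp : cexp (cart 0 (pi *+ 2) : C) = 1.
    by rewrite -[cart 0 _]add0r cexp_2pi cexp0.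
  by rewrite E /F cexp_2pi opprD cexpD (cexpN (cart 0 (pi *+ 2))) cp invr1 mulr1.
pose p2 : R := pi *+ 2.
have p20 : 0 < p2 by rewrite /p2 pmulrn_lgt0 ?pi_gt0.
have p2n n : 0 <= p2 *+ n by rewrite mulrn_wge0 // ltW.
have [V VE] : exists V : R -> C, forall s, V s = cint (fun t => F (cart s t)) 0 p2.
  by exists (fun s => cint (fun t => F (cart s t)) 0 p2).
have Vshift s : s < 0 -> V (s - p2) = V s.
  move=> s0; have := @goursat_square _ F (s - p2) 0 p2 p20.
  rewrite /square_integral subrK add0r -(VE s) -(VE (s - p2)) => H.
  have {}H := H _.
  have bt : cint (fun t => F (cart t p2)) (s - p2) s =
            cint (fun t => F (cart t 0)) (s - p2) s.
    by apply: eq_cint => t _; rewrite -(Fper t) add0r.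
  rewrite bt subrr add0r in H.
  have {}H : cart 0 1 * (V s - V (s - p2)) = 0.
    by apply: H => z [/andP[_ zs] _]; apply: Fd; rewrite (le_lt_trans zs) // subrK.
  have i0 : (cart 0 1 : C) != 0.
    by rewrite -cabs_eq0 cabs_cart expr0n expr1n add0r sqrtr1 oner_eq0.
  have {}H := mulfI i0 (etrans H (esym (mulr0 _))).
  exact: esym (subr0_eq H).
have Vn n : V (- 1 - p2 *+ n) = V (- 1).
  elim: n => [|n IH]; first by rewrite mulr0n subr0.
  have n0 := p2n n.
  have sn : - 1 - p2 *+ n < 0 by lra.
  by rewrite mulrSr opprD addrA (Vshift _ sn) IH.
have Vc s : s < 0 -> cont_segment 0 p2 (fun t => F (cart s t)).
  move=> s0 t _; have [|d /has_cderiv_continuous] := Fd (cart s t); first by [].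
  exact: continuous_vertical.
have M0 : 0 <= M by apply: le_trans (fM 0 _); rewrite ?cabs_ge0 // cabs0.
have N10 : -1 < 0 :> R by lra.
have V1 : cabs (V (- 1)) <= 2 * (2 * M * expR 1) * p2.
  rewrite VE -[p2 in leRHS]subr0; apply: cint_bound; [exact: ltW|exact: Vc|].
  move=> t _; rewrite /F cabsM cabs_cexp /= opprK ler_wpM2r ?expR_ge0 //.
  rewrite (le_trans (cabs_sub _ _)) // mulr_natl mulr2n lerD // fM ?cabs0 //.
  exact: cexp_lt1.
suff main e : 0 < e -> cabs l * p2 <= 2 * (2 * M * expR 1) * p2 + 2 * e * p2.
  apply/ler_addgt0Pr => e e0; have e20 : 0 < e / 2 by rewrite divr_gt0.
  have := main _ e20; rewrite -mulrDl ler_pM2r //; lra.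
move=> e0; move/has_cderivP: (fl) => /(_ e e0) [d d0 H].
(* A circle so small that [(f z - f 0) / z] is within [e] of [l] on it. *)
have [n nd] : exists n, expR (- 1 - p2 *+ n) < d.
  pose n := Num.bound (`|ln d|); exists n.
  rewrite -[d in _ < d](lnK (x := d)) ?posrE // ltr_expR.
  have : `|ln d| < n%:R by apply: archi_boundP.
  have := ler_norm (- ln d); rewrite normrN.
  have : n%:R <= p2 *+ n.
    by rewrite lerMn2r; apply/orP; right; have := @pi_ge2 R; rewrite /p2; lra.
  lra.
set s := _ - _ in nd; have s0 : s < 0.
  have n0 := p2n n; rewrite /s; lra.
have FV : cabs (V s - l * cart p2 0) <= 2 * e * p2.
  rewrite VE -[in cart p2 0](subr0 p2) -(cint_cst _ (ltW p20)) -cintB; last 2 first.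
  - exact: Vc.
  - by move=> t _; exact: ccont_cst.
  rewrite -[p2 in leRHS]subr0; apply: cint_bound; first exact: ltW.
    by move=> t tp; apply: ccontB; [exact: Vc|exact: ccont_cst].
  move=> t _; set z := cart s t.
  have zd : cabs (cexp z - 0) < d by rewrite subr0 cabs_cexp.
  have := H _ zd; rewrite subr0 => Hz.
  have -> : F z - l = (f (cexp z) - f 0 - l * cexp z) * cexp (- z).
    by rewrite mulrBl -mulrA -cexpD subrr cexp0 mulr1.
  rewrite cabsM (le_trans (ler_wpM2r (cabs_ge0 _) Hz)) //.
  by rewrite -mulrA -cabsM -cexpD subrr cexp0 cabs1 mulr1.
have cp : cabs (l * cart p2 0) = cabs l * p2.
  by rewrite cabsM cabs_real gtr0_norm.
have := cabs_sub_ge (l * cart p2 0) (V s).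
rewrite cp (cabsB _ (V s)); have := V1; rewrite -(Vn n) -/s; lra.
Qed.

Lemma hol_affine a b r f : 0 < cabs b -> hol a (r * cabs b) f ->
  hol 0 r (fun z => f (a + b * z)).
Proof.
move=> b0 fh z; rewrite subr0 => zr.
have [|l fl] := fh (a + b * z).
  by rewrite addrAC subrr add0r cabsM mulrC ltr_pM2r.
have d1 := has_cderivM (has_cderiv_cst b z) (has_cderiv_id z).
have d2 := has_cderivD (has_cderiv_cst a z) d1.
by have := has_cderiv_comp d2 fl; set m := _ * _; exists m.
Qed.

Lemma has_cderiv_affine a b f z l : has_cderiv f (a + b * z) l ->
  has_cderiv (fun z => f (a + b * z)) z (l * b).
Proof.
move=> fl.
have d1 := has_cderivM (has_cderiv_cst b z) (has_cderiv_id z).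
have d2 := has_cderivD (has_cderiv_cst a z) d1.
have := has_cderiv_comp d2 fl.
by rewrite mul0r !add0r mulr1.
Qed.

Lemma cauchy_estimate f a r M l : 0 < r -> hol a r f ->
  (forall z, cabs (z - a) < r -> cabs (f z) <= M) ->
  has_cderiv f a l -> cabs l * r <= 4 * expR 1 * M.
Proof.
move=> r0 fh fM fl.
have cr : cabs (cart r 0 : C) = r by rewrite cabs_real gtr0_norm.
have := @cauchy_estimate_unit (fun z => f (a + cart r 0 * z)) M (l * cart r 0).
rewrite cabsM cr; apply.
- by apply: hol_affine; rewrite cr // mul1r.
- move=> z z1; apply: fM; rewrite addrAC subrr add0r cabsM cr.
  by rewrite -[ltRHS]mulr1 ltr_pM2l.
- by apply: has_cderiv_affine; rewrite mulr0 addr0.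
Qed.

End CauchyEstimate.

(** * Holomorphic functions on discs, logarithms and roots *)

Section HolomorphicOnDiscs.
Context {R : realType}.
Local Notation C := (Cplx R).
Implicit Types (r s t B M : R) (f g : C -> C) (a z l : C).

Lemma hol_derive1 a r f z : hol a r f -> cabs (z - a) < r ->
  has_cderiv f z (derive1 f z).
Proof.
by move=> fh /fh[l fl]; have [_ ->] := has_cderiv_is_derive fl.
Qed.

Lemma hol_continuous a r f z : hol a r f -> cabs (z - a) < r ->
  {for z, continuous f}.
Proof. by move=> fh /fh[l]; exact: has_cderiv_continuous. Qed.

Lemma hol_sub a r s f : s <= r -> hol a r f -> hol a s f.
Proof. by move=> sr fh z zs; apply: fh; exact: lt_le_trans sr. Qed.

Lemma hol_subdisc a b r s f : cabs (b - a) + s <= r -> hol a r f -> hol b s f.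
Proof.
move=> sr fh z zs; apply: fh; rewrite (le_lt_trans (cabs_triangle b z a)) //.
by rewrite (lt_le_trans _ sr) // addrC ltrD2l.
Qed.

Lemma hol_cst a r c : hol a r (fun=> c).
Proof. by move=> z _; exists 0; exact: has_cderiv_cst. Qed.

Lemma holD a r f g : hol a r f -> hol a r g -> hol a r (fun z => f z + g z).
Proof.
move=> fh gh z zr; have [l fl] := fh z zr; have [m gm] := gh z zr.
by exists (l + m); exact: has_cderivD.
Qed.

Lemma holM a r f g : hol a r f -> hol a r g -> hol a r (fun z => f z * g z).
Proof.
move=> fh gh z zr; have [l fl] := fh z zr; have [m gm] := gh z zr.
by exists (l * g z + f z * m); exact: has_cderivM.
Qed.

Lemma holB a r f g : hol a r f -> hol a r g -> hol a r (fun z => f z - g z).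
Proof.
move=> fh gh; have := holD fh (holM (@hol_cst a r (-1)) gh).
by under [X in hol _ _ X]eq_fun do rewrite mulN1r.
Qed.

Lemma hol_cexp a r f : hol a r f -> hol a r (fun z => cexp (f z)).
Proof.
move=> fh z zr; have [l fl] := fh z zr; exists (cexp (f z) * l).
exact: (has_cderiv_comp fl (has_cderiv_cexp _)).
Qed.

Lemma mean_value_Re f a b l t : has_cderiv f (a + cart t 0 * b) l ->
  is_derive t 1 (fun s => complex.Re (f (a + cart s 0 * b))) (complex.Re (l * b)).
Proof.
move=> [phi [phic <- fE]]; apply/is_derive1_caratheodory.
exists (fun s => complex.Re (phi (a + cart s 0 * b) * b)); split.
- move=> s; rewrite -ReB fE.
  rewrite (_ : a + cart s 0 * b - (a + cart t 0 * b) = cart (s - t) 0 * b).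
    rewrite mulrA mulrAC; case: (phi _ * b) => x y /=; ring.
  have -> : cart (s - t) 0 = cart s 0 - cart t 0 by rewrite cartB subrr.
  ring.
- have cc : {for t, continuous (fun s : R => a + cart s 0 * b)}.
    apply: ccontD; first exact: ccont_cst.
    apply: ccontM; last exact: ccont_cst.
    by apply: (@cvg_cart _ _ (nbhs t) _); [exact: cvg_id|exact: cvg_cst].
  have pc := continuous_comp cc phic.
  have mc : {for t, continuous (fun s : R => phi (a + cart s 0 * b) * b)}.
    by apply: ccontM; [exact: pc|exact: ccont_cst].
  exact: (continuous_comp mc (@Re_continuous _ _)).
- by [].
Qed.

Lemma mean_value_inequality_Re f a r B z : hol a r f ->
  (forall w, cabs (w - a) < r -> cabs (derive1 f w) <= B) ->
  cabs (z - a) < r ->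
  `|complex.Re (f z) - complex.Re (f a)| <= B * cabs (z - a).
Proof.
move=> fh fB zr.
pose p t := a + cart t 0 * (z - a).
have pin (t : R) : 0 <= t <= 1 -> cabs (p t - a) < r.
  move=> /andP[t0 t1]; rewrite /p addrAC subrr add0r cabsM cabs_real ger0_norm //.
  by apply: le_lt_trans zr; rewrite -[leRHS]mul1r ler_wpM2r // cabs_ge0.
pose h t := complex.Re (f (p t)).
have hd (t : R) : 0 <= t <= 1 -> is_derive t 1 h (complex.Re (derive1 f (p t) * (z - a))).
  by move=> /pin tr; apply: mean_value_Re; exact: (hol_derive1 fh tr).
have [||c c01] := @MVT _ h (fun t => complex.Re (derive1 f (p t) * (z - a))) 0 1 ltr01.
- move=> t; rewrite in_itv /= => /andP[t0 t1]; apply: hd; rewrite !ltW //.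
- apply: continuous_in_subspaceT => t; rewrite inE /= in_itv /= => /hd td.
  apply: differentiable_continuous; apply/derivable1_diffP.
  exact: (@ex_derive _ _ _ _ _ _ _ td).
have p0 : p 0 = a by rewrite /p (_ : cart 0 0 = 0) // mul0r addr0.
have p1 : p 1 = z by rewrite /p (_ : cart 1 0 = 1) // mul1r addrC subrK.
rewrite /h p0 p1 subr0 mulr1 => ->; apply: le_trans (Re_le_cabs _) _.
rewrite cabsM ler_wpM2r ?cabs_ge0 // fB // pin //.
by move: c01; rewrite in_itv /= => /andP[c0 c1]; rewrite !ltW.
Qed.

(** As in [cint_bound], the factor 2 comes from the two coordinates. *)
Lemma mean_value_inequality f a r B z : hol a r f ->
  (forall w, cabs (w - a) < r -> cabs (derive1 f w) <= B) ->
  cabs (z - a) < r -> cabs (f z - f a) <= 2 * B * cabs (z - a).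
Proof.
move=> fh fB zr; rewrite (le_trans (cabs_le_ReIm _)) // ReB ImB.
rewrite -mulrA mulr_natl mulr2n.
apply: lerD; first exact: (mean_value_inequality_Re fh fB zr).
have gh : hol a r (fun z => - cart 0 1 * f z).
  exact: (holM (@hol_cst a r (- cart 0 1)) fh).
have ReI (w : C) : complex.Re (- cart 0 1 * w) = complex.Im w.
  by case: w => x y; rewrite /cart /=; ring.
rewrite -(ReI (f z)) -(ReI (f a)).
apply: (mean_value_inequality_Re gh _ zr) => w wr.
have := has_cderivM (has_cderiv_cst (- cart 0 1) w) (hol_derive1 fh wr).
move=> /has_cderiv_is_derive[_ ->]; rewrite mul0r add0r cabsM cabsN cabs_cart.
by rewrite expr0n expr1n add0r sqrtr1 mul1r fB.
Qed.

(** With [N] large, uniform continuity makes each factor of the telescoping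
    product
    [f z = f 0 * prod_k f ((k + 1) z / N) / f (k z / N)]
    lie in the disc of centre 1 and radius 1, where [clog] applies. *)
Lemma exists_hol_log f r s l0 : 0 < s -> s < r -> hol 0 r f ->
  (forall z, cabs z < r -> f z != 0) -> cexp l0 = f 0 ->
  exists L, [/\ hol 0 s L, forall z, cabs z < s -> cexp (L z) = f z & L 0 = l0].
Proof.
move=> s0 sr fh f0 l0E.
have [d d0 close] : exists2 d : R, 0 < d & forall z, cabs z <= s ->
    forall w, cabs (w - z) < d -> cabs (f w - f z) < cabs (f z).
  apply: (disc_uniform (Q := fun d z => forall w, cabs (w - z) < d ->
    cabs (f w - f z) < cabs (f z))) => //.
    by move=> d d' z /andP[_ dd] H w wz; apply: H; exact: lt_le_trans dd.
  move=> p ps; have pr : cabs p < r by exact: le_lt_trans sr.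
  have fp : 0 < cabs (f p) / 4 by rewrite divr_gt0 // cabs_gt0 f0.
  have fc : {for p, continuous f} by apply: (hol_continuous fh); rewrite subr0.
  move/continuous_cabsP: fc => /(_ _ fp)[d d0 H].
  exists (d / 2); first by rewrite divr_gt0.
  move=> z zp w wz.
  have A : cabs (f z - f p) < cabs (f p) / 4 by apply: H; lra.
  have B : cabs (f w - f p) < cabs (f p) / 4.
    by apply: H; have := cabs_triangle z w p; lra.
  have := cabs_triangle (f p) (f w) (f z); have := cabs_sub_ge (f p) (f z).
  by rewrite (cabsB (f p) (f z)); lra.
pose N := (Num.bound (s / d)).+1.
have N0 : (N%:R : R) != 0 by rewrite pnatr_eq0.
have Nd : s / N%:R < d.
  rewrite ltr_pdivrMr ?ltr0n // mulrC -ltr_pdivrMr //.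
  have : s / d < (Num.bound (s / d))%:R by apply: archi_boundP; rewrite divr_ge0 ?ltW.
  by move=> /lt_trans; apply; rewrite ltr_nat.
pose c k : C := cart (k%:R / N%:R) 0.
have cz k z : (k <= N)%N -> cabs (c k * z) <= cabs z.
  move=> kN; rewrite cabsM cabs_real ger0_norm ?divr_ge0 //.
  by rewrite -[leRHS]mul1r ler_wpM2r ?cabs_ge0 // ler_pdivrMr ?ltr0n // mul1r ler_nat.
have fch k : (k <= N)%N -> hol 0 s (fun z => f (c k * z)).
  move=> kN z; rewrite subr0 => zs.
  have [|l fl] := fh (0 + c k * z).
    by rewrite add0r subr0 (le_lt_trans (cz k z kN)) // (lt_trans zs).
  exists (l * c k); have := has_cderiv_affine fl.
  by under [X in has_cderiv X _ _]eq_fun do rewrite add0r.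
suff main k : (k <= N)%N -> exists L, [/\ hol 0 s L,
    forall z, cabs z < s -> cexp (L z) = f (c k * z) & L 0 = l0].
  have [L [Lh LE L0]] := main N (leqnn _); exists L; split => // z zs.
  by rewrite LE // /c divff // (_ : cart 1 0 = 1) // mul1r.
elim: k => [_|k IH kN].
  exists (fun=> l0); split=> // [|z _]; first exact: hol_cst.
  by rewrite l0E /c mul0r (_ : cart 0 0 = 0) // mul0r.
have [L [Lh LE L0]] := IH (ltnW kN).
have fcn0 j z : (j <= N)%N -> cabs z < s -> f (c j * z) != 0.
  by move=> jN zs; rewrite f0 // (le_lt_trans (cz j z jN)) // (lt_trans zs).
pose q z := f (c k.+1 * z) / f (c k * z).
have qRe z : cabs z < s -> 0 < complex.Re (q z).
  move=> zs; have fk0 := fcn0 k z (ltnW kN) zs.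
  have q1 : cabs (q z - 1) < 1.
    rewrite /q -[1 in X in cabs X](divff fk0) -mulrBl cabs_div ltr_pdivrMr ?cabs_gt0 //.
    rewrite mul1r; apply: close; first by rewrite (le_trans (cz k z (ltnW kN))) // ltW.
    rewrite -mulrBl /c cartB subr0 -mulrBl -natrB // subSnn cabsM cabs_real.
    rewrite mul1r ger0_norm ?invr_ge0 // mulrC; apply: le_lt_trans Nd.
    by rewrite ler_wpM2r ?invr_ge0 // ltW.
  by have := Re_le_cabs (q z - 1); rewrite ReB /= ler_norml; lra.
exists (fun z => L z + clog (q z)); split.
- apply: holD => // z; rewrite subr0 => zs.
  have zs' : cabs (z - 0) < s by rewrite subr0.
  have [l1 H1] := fch k.+1 kN z zs'; have [l2 H2] := fch k (ltnW kN) z zs'.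
  have H3 := has_cderiv_comp H2 (has_cderiv_inv (fcn0 k z (ltnW kN) zs)).
  have H4 := has_cderivM H1 H3.
  by have := has_cderiv_comp H4 (has_cderiv_clog (qRe z zs)); set m := (_ * _); exists m.
- move=> z zs; rewrite cexpD LE // clogK ?qRe // /q mulrC divfK //.
  exact: fcn0 (ltnW kN) zs.
- rewrite L0 /q !mulr0 divff ?clog1 ?addr0 // f0 // cabs0.
  exact: lt_trans sr.
Qed.

Lemma exists_hol_sqrt f r s : 0 < s -> s < r -> hol 0 r f ->
  (forall z, cabs z < r -> f z != 0) ->
  exists q, hol 0 s q /\ forall z, cabs z < s -> q z ^+ 2 = f z.
Proof.
move=> s0 sr fh f0.
have [|l [lE _ _]] := @exists_log _ (f 0); first by rewrite f0 // cabs0 (lt_trans s0).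
have [L [Lh LE _]] := exists_hol_log s0 sr fh f0 lE.
exists (fun z => cexp (2^-1 * L z)); split.
  by apply: hol_cexp; apply: holM => //; exact: hol_cst.
have half2 : 2^-1 + 2^-1 = 1 :> C by rewrite -mulr2n -[LHS]mulr_natr mulVf // pnatr_eq0.
by move=> z zs; rewrite -(LE z zs) expr2 -cexpD -mulrDl half2 mul1r.
Qed.

End HolomorphicOnDiscs.

(** * Bloch's theorem for functions omitting a net *)

Section BlochLandau.
Context {R : realType}.
Local Notation C := (Cplx R).
Implicit Types (r s t x y A B M : R) (f g : C -> C) (a z l w : C).
Local Notation K := (4 * expR 1 : R).

(** Landau's square root trick.  Since [1 - g / w] has no zero it has a square
    root [q], and [cabs q] is at most [sqrt (1 + A / cabs w)].  Cauchy's
    estimate for [q' 0 = - g' 0 / (2 w q 0)] bounds [g' 0] by a quantity that is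
    sublinear in [A]: this gain is what makes Bloch's theorem work. *)
Lemma omitted_value_bound_unit g A w : hol 0 1 g -> g 0 = 0 ->
  (forall z, cabs z < 1 -> cabs (g z) <= A) ->
  (forall z, cabs z < 1 -> g z != w) ->
  cabs (derive1 g 0) ^+ 2 <= (4 * K) ^+ 2 * (cabs w ^+ 2 + A * cabs w).
Proof.
move=> gh g0 gA gw.
have w0 : w != 0 by have := gw 0; rewrite cabs0 g0 eq_sym => /(_ ltr01).
have cw0 : 0 < cabs w by rewrite cabs_gt0.
pose h z := 1 - w^-1 * g z.
have hh : hol 0 1 h.
  by apply: holB; [exact: hol_cst|apply: holM => //; exact: hol_cst].
have h0 z : cabs z < 1 -> h z != 0.
  move=> /gw; apply: contraNN; rewrite subr_eq0 => /eqP H.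
  by rewrite -[g z]mul1r -(divff w0) -mulrA -H mulr1.
have half1 : 2^-1 < 1 :> R by lra.
have half0 : 0 < 2^-1 :> R by rewrite invr_gt0.
have [q [qh qE]] := exists_hol_sqrt half0 half1 hh h0.
(* [T] bounds [h], so that [sqrt T] bounds [q]. *)
pose T := 1 + A / cabs w.
have qT z : cabs (z - 0) < 2^-1 -> cabs (q z) <= Num.sqrt T.
  rewrite subr0 => zs.
  have : cabs (q z) ^+ 2 <= T.
    rewrite -cabsX qE // (le_trans (cabs_sub _ _)) // cabs1 lerD2l cabsM cabsV.
    by rewrite mulrC ler_wpM2r ?invr_ge0 ?cabs_ge0 // gA // (lt_trans zs).
  move=> H; rewrite -[leLHS]ger0_norm ?cabs_ge0 // -sqrtr_sqr ler_wsqrtr //.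
have z0 : cabs (0 - 0 : C) < 2^-1 by rewrite subr0 cabs0.
have dq := hol_derive1 qh z0.
have dg : has_cderiv g 0 (derive1 g 0).
  by apply: (hol_derive1 gh); rewrite subr0 cabs0.
have E : derive1 q 0 * q 0 + q 0 * derive1 q 0 = - (w^-1 * derive1 g 0).
  apply: (@has_cderiv_unique _ h 0).
    apply: has_cderiv_ext (has_cderivM dq dq).
    by apply/cnbhsP; exists 2^-1 => // z; rewrite subr0 -expr2 => /qE.
  have := has_cderivM (has_cderiv_cst (- w^-1) 0) dg.
  move/(has_cderivD (has_cderiv_cst 1 0)).
  rewrite mul0r !add0r mulNr; apply: has_cderiv_ext.
  by apply/cnbhsP; exists 1 => // z _; rewrite mulNr.
have q01 : cabs (q 0) = 1.
  have := qE 0; rewrite cabs0 => /(_ half0).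
  rewrite /h g0 mulr0 subr0 => /(congr1 (@cabs R)); rewrite cabsX cabs1 => /eqP.
  by rewrite sqrp_eq1 ?cabs_ge0 // => /eqP.
have E2 : 2 * cabs (derive1 q 0) * cabs w = cabs (derive1 g 0).
  have : cabs (derive1 q 0 * q 0 + q 0 * derive1 q 0) = 2 * cabs (derive1 q 0).
    have -> : derive1 q 0 * q 0 + q 0 * derive1 q 0 = 2%:R * (derive1 q 0 * q 0).
      by ring.
    by rewrite !cabsM cabs_nat q01 mulr1.
  by rewrite E cabsN cabsM cabsV => <-; rewrite mulrAC mulVf ?mul1r // gt_eqF.
have := cauchy_estimate half0 qh qT dq.
rewrite ler_pdivrMr // => H.
rewrite -E2.
have T0 : 0 <= T.
  have A0 : 0 <= A by apply: le_trans (gA 0 _); rewrite ?cabs_ge0 // cabs0.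
  by rewrite addr_ge0 // divr_ge0 // ltW.
have -> : (4 * K) ^+ 2 * (cabs w ^+ 2 + A * cabs w) =
    (2 * (K * Num.sqrt T * 2) * cabs w) ^+ 2.
  rewrite !exprMn sqr_sqrtr // /T; field; exact: lt0r_neq0.
rewrite ler_pXn2r ?nnegrE ?mulr_ge0 ?cabs_ge0 ?expR_ge0 ?sqrtr_ge0 //.
by rewrite ler_wpM2r ?cabs_ge0 // ler_wpM2l.
Qed.

Lemma omitted_value_bound g a r A w : 0 < r -> hol a r g ->
  (forall z, cabs (z - a) < r -> cabs (g z - g a) <= A) ->
  (forall z, cabs (z - a) < r -> g z != w) ->
  (cabs (derive1 g a) * r) ^+ 2 <=
    (4 * K) ^+ 2 * (cabs (w - g a) ^+ 2 + A * cabs (w - g a)).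
Proof.
move=> r0 gh gA gw.
have cr : cabs (cart r 0 : C) = r by rewrite cabs_real gtr0_norm.
have ain z : cabs z < 1 -> cabs (a + cart r 0 * z - a) < r.
  by move=> z1; rewrite addrAC subrr add0r cabsM cr -[ltRHS]mulr1 ltr_pM2l.
pose f z := g (a + cart r 0 * z) - g a.
have fh : hol 0 1 f.
  apply: holB; last exact: hol_cst.
  by apply: hol_affine; rewrite cr // mul1r.
have ra0 : a + cart r 0 * 0 = a by rewrite mulr0 addr0.
have fd : derive1 f 0 = derive1 g a * cart r 0.
  have ga : has_cderiv g a (derive1 g a).
    by apply: (hol_derive1 gh); rewrite subrr cabs0.
  rewrite -{1}ra0 in ga.
  have := has_cderivD (has_cderiv_affine ga) (has_cderiv_cst (- g a) 0).
  by rewrite addr0 => /has_cderiv_is_derive[].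
rewrite -{1}cr -cabsM -fd; apply: (omitted_value_bound_unit fh).
- by rewrite /f ra0 subrr.
- by move=> z z1; rewrite /f gA // ain.
- move=> z z1; apply/eqP => /eqP; rewrite /f subr_eq subrK => /eqP.
  by apply/eqP; rewrite gw // ain.
Qed.

Definition omits_net (d : R) (D : set C) g :=
  forall p, exists2 w, cabs (w - p) <= d & forall z, D z -> g z != w.

(** With [A] the supremum of [(1/2 - cabs z) * cabs (g' z)] on the disc of radius
    1/2, take a point [z0] where it is nearly attained and [t] half the
    distance from [z0] to the boundary.  On the disc of centre [z0] and radius
    [t] the oscillation of [g] is at most [2 A] whereas [t * cabs (g' z0)] is at
    least [A / 4].  As a value near [g z0] is omitted, [omitted_value_bound] gives
    [A ^ 2 <= c (1 + A)] for a universal [c], so [A] is bounded. *)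
Lemma bloch_landau_unit : exists2 B : R, 0 < B & forall g, hol 0 1 g ->
  omits_net 8 [set z | cabs z < 1] g -> cabs (derive1 g 0) <= B.
Proof.
pose c : R := 16 * (4 * K) ^+ 2.
have c1 : 1 <= c.
  have e1 : 1 <= expR 1 :> R by have := @expR_ge1Dx R 1; lra.
  have : 1 <= (4 * K) ^+ 2 by rewrite expr_ge1 //; lra.
  rewrite /c; lra.
pose B := 2 * (16 * c + 8 + 16).
exists B => [|g gh gnet]; first by rewrite /B; lra.
have half0 : 0 < 2^-1 :> R by rewrite invr_gt0.
have [M M0 gM] : exists2 M : R, 0 < M & forall z, cabs z <= 3 / 4 -> cabs (g z) <= M.
  apply: disc_bounded; first lra.
  by move=> z zr; apply: (hol_continuous gh); rewrite subr0; lra.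
have g'M z : cabs z < 2^-1 -> cabs (derive1 g z) <= K * M * 4.
  move=> zr; have q0 : 0 < 4^-1 :> R by rewrite invr_gt0.
  have zz : cabs (z - 0) < 1 by rewrite subr0; lra.
  have := cauchy_estimate q0 (hol_subdisc _ gh) _ (hol_derive1 gh zz).
  rewrite subr0; move=> /(_ M); rewrite ler_pdivrMr //; apply; first lra.
  move=> w wz; apply: gM; have := cabs_sub_ge w z; lra.
pose S := [set (2^-1 - cabs z) * cabs (derive1 g z) | z in [set z : C | cabs z < 2^-1]].
have S0 : S (2^-1 * cabs (derive1 g 0)).
  by exists 0; [rewrite /mkset cabs0|rewrite cabs0 subr0].
have ubS : has_ubound S.
  exists (2^-1 * (K * M * 4)) => _ [z /= zr <-].
  apply: ler_pM; rewrite ?cabs_ge0 ?g'M //; last by have := cabs_ge0 z; lra.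
  by rewrite subr_ge0 ltW.
have [A AE] : exists A : R, A = sup S by exists (sup S).
have SA x : S x -> x <= A by move=> ?; rewrite AE; exact: ub_le_sup.
have A_ge : 2^-1 * cabs (derive1 g 0) <= A by exact: SA.
have A0 : 0 <= A by apply: le_trans A_ge; rewrite mulr_ge0 ?cabs_ge0 // ltW.
suff : A <= 16 * c + 8 + 16 by rewrite /B; lra.
have [A00|Apos] := leP A 0; first lra.
(* The supremum need not be attained; half of it is exceeded at [z0]. *)
have [|_ [z0 /= z0r <-] z0A] := @sup_adherent _ S (A / 2) _ (conj (ex_intro _ _ S0) ubS).
  by rewrite divr_gt0.
rewrite -AE in z0A.
have [t tE t0] : exists2 t : R, t * 2 = 2^-1 - cabs z0 & 0 < t.
  by exists ((2^-1 - cabs z0) / 2); rewrite ?divfK // divr_gt0 // subr_gt0.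
have g0h : hol z0 t g.
  have zt : cabs (z0 - 0) + t <= 1.
    rewrite subr0.
    have c0 := cabs_ge0 z0.
    clear -tE t0 z0r c0.
    lra.
  exact: (hol_subdisc zt gh).
have g'A z : cabs (z - z0) < t -> cabs (derive1 g z) <= A / t.
  move=> zt; have zz : t <= 2^-1 - cabs z.
    by move: (cabs_sub_ge z z0) tE zt; clear; lra.
  rewrite ler_pdivlMr // mulrC; apply: le_trans (SA _ _); last first.
    by exists z => //=; move: t0 zz; clear; lra.
  by rewrite ler_wpM2r // cabs_ge0.
have gA z : cabs (z - z0) < t -> cabs (g z - g z0) <= 2 * A.
  move=> zt; have := mean_value_inequality g0h g'A zt.
  move=> /le_trans; apply; rewrite -mulrA ler_wpM2l // mulrAC ler_pdivrMr //.
  by rewrite ler_wpM2l // ltW.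
have [w wd gw] := gnet (g z0).
have gw' z : cabs (z - z0) < t -> g z != w.
  
  move=> zt; apply: gw => /=.
  by move: (cabs_sub_ge z z0) (cabs_ge0 z0) tE t0 zt; clear; lra.
have := omitted_value_bound t0 g0h gA gw'.
set D := cabs (w - _) in wd *; set X := cabs (derive1 g z0) * t => H.
have D0 : 0 <= D by exact: cabs_ge0.
have XA : A / 4 <= X.
  have tE' : 2^-1 - cabs z0 = 2 * t by rewrite -tE mulrC.
  by move: z0A; rewrite tE' -mulrA (mulrC t) -/X; clear; lra.
have H1 : (A / 4) ^+ 2 <= X ^+ 2.
  by rewrite ler_pXn2r ?nnegrE ?divr_ge0 // (le_trans _ XA) ?divr_ge0.
have H2 : D ^+ 2 + 2 * A * D <= 8 ^+ 2 + 2 * A * 8.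
  rewrite lerD // ?ler_pXn2r ?nnegrE // ler_wpM2l // mulr_ge0 //.
have H3 : (A / 4) ^+ 2 * 16 <= c * (8 ^+ 2 + 2 * A * 8).
  rewrite /c mulrC -mulrA ler_wpM2l //.
  apply: le_trans H1 (le_trans H _); rewrite ler_wpM2l // sqr_ge0.
have EA : (A / 4) ^+ 2 * 16 = A ^+ 2 by field.
rewrite EA in H3.
rewrite leNgt; apply/negP => AB.
have : (16 * c + 8 + 16) * A < A ^+ 2 by rewrite expr2 ltr_pM2r.
by move: H3 c1 AB; clear; lra.
Qed.

(** The form of Bloch's theorem used by Landau: a function whose omitted values
    meet every disc of a fixed radius has a bounded derivative. *)
Lemma bloch_landau : exists2 B : R, 0 < B & forall g a r, 0 < r -> hol a r g ->
  omits_net 8 [set z | cabs (z - a) < r] g -> cabs (derive1 g a) * r <= B.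
Proof.
have [B B0 H] := bloch_landau_unit; exists B => // g a r r0 gh gnet.
have cr : cabs (cart r 0 : C) = r by rewrite cabs_real gtr0_norm.
have ra0 : a + cart r 0 * 0 = a by rewrite mulr0 addr0.
have ga : has_cderiv g a (derive1 g a).
  by apply: (hol_derive1 gh); rewrite subrr cabs0.
rewrite -{1}ra0 in ga.
have [_ fd] := has_cderiv_is_derive (has_cderiv_affine ga).
rewrite -{1}cr -cabsM -fd; apply: H.
  by apply: hol_affine; rewrite cr // mul1r.
move=> p; have [w wp gw] := gnet p; exists w => // z /= z1; apply: gw => /=.
by rewrite addrAC subrr add0r cabsM cr -[ltRHS]mulr1 ltr_pM2l.
Qed.

End BlochLandau.

(** * The net of points where the squared hyperbolic cosine is an integer *)

Section CoshNet.
Context {R : realType}.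
Local Notation C := (Cplx R).
Implicit Types (r s t x y A B M : R) (f g : C -> C) (a z l w p : C).

Lemma cexp_half_period_sqr (E : R) w (m : int) :
  w = cart (ln E) 0 + cart 0 pi *~ m -> 0 < E -> cexp w ^+ 2 = cart (E ^+ 2) 0.
Proof.
move=> -> E0; rewrite expr2 -cexpD.
have -> : cart (ln E) 0 + cart 0 pi *~ m + (cart (ln E) 0 + cart 0 pi *~ m) =
    cart (ln E) 0 + cart (ln E) 0 + cart 0 (pi *+ 2) *~ m :> C.
  rewrite addrACA -mulrzDl; congr (_ + _ *~ _).
  by rewrite cartD addr0 mulr2n.
rewrite cexpD cexp_2pi_int mulr1 cexpD /cexp /= cos0 sin0 lnK ?posrE //.
by rewrite mulr1 mulr0 cartM; congr cart; ring.
Qed.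

(** The points [ln (sqrt n + sqrt (n - 1)) + i pi m], at which [cosh ^ 2] takes
    the value [n], come within a bounded distance of every point of the
    half-plane: taking [n] close to [exp (2 x)] brings the real part within 1 of [x], and the
    imaginary parts are spaced by [pi < 4], so that the radius 8 is enough. *)
Lemma cosh_net_half_plane x y : 0 <= x -> exists2 w : C,
  cabs (w - cart x y) <= 8 & exists n : nat, (cexp w + cexp (- w)) ^+ 2 = 4 * n%:R.
Proof.
move=> x0.
have ex1 : 1 <= expR (x *+ 2) by rewrite -expR0 ler_expR mulrn_wge0.
(* [E = sqrt n + sqrt (n - 1)] has inverse [s - s'], and [E ^+ 2] lies between
   [n] and [4 * n]: it is comparable to [exp (2 x)]. *)
pose n := Num.truncn (expR (x *+ 2)).
have /andP[n1 n2] := truncn_itv (expR_ge0 (x *+ 2)); rewrite -/n in n1 n2.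
have n0 : (0 < n)%N by rewrite lt0n; apply/eqP => n00; move: n2; rewrite n00; lra.
have nR : 1 <= n%:R :> R by rewrite ler1n.
pose s := Num.sqrt (n%:R : R); pose s' := Num.sqrt (n%:R - 1 : R).
have s2 : s ^+ 2 = n%:R by rewrite sqr_sqrtr.
have s'2 : s' ^+ 2 = n%:R - 1 by rewrite sqr_sqrtr // subr_ge0.
have s'0 : 0 <= s' by exact: sqrtr_ge0.
have s0 : 0 < s by rewrite sqrtr_gt0 ltr0n.
have s's : s' <= s by rewrite ler_wsqrtr //; lra.
pose E := s + s'; have E0 : 0 < E by rewrite ltr_pwDl.
have EV : E * (s - s') = 1.
  by rewrite mulrC /E -subr_sqr s2 s'2; ring.
pose m := Num.floor (y / pi).
have pi0 := @pi_gt0 R.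
pose w : C := cart (ln E) 0 + cart 0 pi *~ m; exists w; last first.
  have w2 := cexp_half_period_sqr (erefl w) E0.
  have wV : cexp w * cexp (- w) = 1 by rewrite -cexpD subrr cexp0.
  have w2' : cexp (- w) ^+ 2 = cart ((s - s') ^+ 2) 0.
    have ww : cexp w ^+ 2 * cexp (- w) ^+ 2 = 1 by rewrite -exprMn wV expr1n.
    have w20 : cexp w ^+ 2 != 0 by rewrite expf_neq0 // cexp_neq0.
    apply: (mulfI w20); rewrite ww w2 cartM -cart1 !mulr0 mul0r subr0 addr0.
    by rewrite -exprMn EV expr1n.
  exists n; rewrite sqrrD wV w2 w2' -(cart_nat 4) -(cart_nat n) -(cart_nat 2).
  rewrite !cartD cartM; congr cart; last by ring.
  have -> : E ^+ 2 + 2 + (s - s') ^+ 2 = 2 * s ^+ 2 + 2 * s' ^+ 2 + 2.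
    by rewrite /E; ring.
  by rewrite s2 s'2; ring.
have mz : cart 0 pi *~ m = cart 0 (pi * m%:~R) :> C.
  have H k : cart 0 pi *+ k = cart 0 (pi * k%:R) :> C.
    elim: k => [|k IH]; first by rewrite mulr0n mulr0.
    by rewrite mulrSr IH cartD addr0 -natr1 mulrDr mulr1.
  by case: (m) => k; rewrite ?NegzE ?mulrNz -?pmulrn H // cartN oppr0 mulrN.
have wE : w - cart x y = cart (ln E - x) (pi * m%:~R - y).
  by rewrite /w mz cartD addr0 add0r cartB.
rewrite wE (le_trans (cabs_le_ReIm _)) //=.
have e2 : 2 <= expR 1 :> R by have := @expR_ge1Dx R 1; lra.
have E2l : n%:R <= E ^+ 2 by rewrite -s2 ler_pXn2r ?nnegrE ?lerDl // ltW.
have E2u : E ^+ 2 <= 4 * n%:R.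
  rewrite -s2 (_ : 4 * s ^+ 2 = (s + s) ^+ 2); last by ring.
  by rewrite ler_pXn2r ?nnegrE ?lerD2l ?addr_ge0 // ltW.
have xE : expR x ^+ 2 = expR (x *+ 2) by rewrite mulr2n expRD expr2.
have Eu : E <= expR (x + 1).
  rewrite -(@ler_pXn2r _ 2) ?nnegrE ?expR_ge0 //; last exact: ltW.
  rewrite expRD exprMn xE (le_trans E2u) // mulrC ler_pM //.
  rewrite (_ : 4 = 2 ^+ 2); last by ring.
  by rewrite ler_pXn2r ?nnegrE ?expR_ge0.
have El : expR (x - 1) <= E.
  rewrite -(@ler_pXn2r _ 2) ?nnegrE ?expR_ge0 //; last exact: ltW.
  apply: le_trans E2l; rewrite expRD exprMn xE expRN.
  have h1 : (expR 1)^-1 <= 2^-1 :> R by rewrite lef_pV2 ?posrE // expR_gt0.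
  have h2 : (expR 1)^-1 ^+ 2 <= 2^-1 ^+ 2 :> R.
    by rewrite ler_pXn2r ?nnegrE ?invr_ge0 ?expR_ge0.
  apply: (@le_trans _ _ (expR (x *+ 2) * 2^-1 ^+ 2)).
    by rewrite ler_wpM2l // expR_ge0.
  move: n2; rewrite -natr1; move: nR ex1; set u := expR _; set v := n%:R.
  clear; lra.
have h1 : `|ln E - x| <= 1.
  have := Eu; have := El; rewrite -{1 2}(lnK (x := E)) ?posrE // !ler_expR.
  by rewrite ler_norml; clear; lra.
have h2 : `|pi * m%:~R - y| <= pi.
  have := floor_itv (y / pi); rewrite -/m.
  rewrite ler_pdivlMr // ltr_pdivrMr // intrD => /andP[].
  by rewrite ler_norml mulrDl mul1r (mulrC pi); clear -pi0; lra.
have p4 : pi < 4 :> R by have := @pihalf_lt2 R; clear; lra.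
by move: h1 h2 p4; clear; lra.
Qed.

Lemma cosh_net p : exists2 w : C,
  cabs (w - p) <= 8 & exists n : nat, (cexp w + cexp (- w)) ^+ 2 = 4 * n%:R.
Proof.
case: p => x y; rewrite -/(cart x y).
have [x0|x0] := leP 0 x; first exact: cosh_net_half_plane.
have [|w wp [n wn]] := @cosh_net_half_plane (- x) (- y); first by rewrite oppr_ge0 ltW.
exists (- w); last by exists n; rewrite opprK addrC.
by rewrite -cabsN opprB addrC opprK -[cart x y]opprK cartN.
Qed.

End CoshNet.

(** * Schottky's theorem *)

Section SchottkyTheorem.
Context {R : realType}.
Local Notation C := (Cplx R).
Implicit Types (r s t x y rho A B M T : R) (f g F : C -> C) (a z l w p : C).

Lemma cabs_cexp_le z x : cabs z <= x -> cabs (cexp z) <= expR x.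
Proof.
move=> zx; rewrite cabs_cexp ler_expR (le_trans _ zx) //.
exact: le_trans (ler_norm _) (Re_le_cabs _).
Qed.

Lemma ln_norm_le t T : 0 < t -> t <= T -> t^-1 <= T -> `|ln t| <= ln T.
Proof.
move=> t0 tT tVT; have T0 : 0 < T by exact: lt_le_trans tT.
rewrite ler_norml; apply/andP; split; last by rewrite ler_ln ?posrE.
by rewrite lerNl -lnV ?posrE // ler_ln ?posrE ?invr_gt0.
Qed.

(** If [F] omits 0 and 1, the square roots [u] of [F] and [v] of [F - 1] satisfy
    [(u - v) (u + v) = 1], so [u - v = exp G] gives [F = cosh ^ 2 G].  When [F]
    omits all natural numbers, [G] omits the net of [cosh_net], its derivative is
    bounded by [bloch_landau], and a bound of [G] gives one of [F]. *)
Lemma avoid_nat_bound rho T : 0 < rho -> rho < 1 -> 0 <= T ->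
  exists M : R, forall F, hol 0 1 F ->
    (forall z, cabs z < 1 -> forall n : nat, F z != n%:R) ->
    cabs (F 0) <= T -> forall z, cabs z <= rho -> cabs (F z) <= M.
Proof.
move=> rho0 rho1 T0.
have [B B0 HB] := @bloch_landau R.
(* Room is lost three times between [rho] and 1: for the square roots, for the
   logarithm [G], and for the discs of radius [e] on which [G'] is estimated. *)
have [e e0 eE] : exists2 e : R, 0 < e & rho + 4 * e = 1.
  by exists ((1 - rho) / 4); [rewrite divr_gt0 // subr_gt0|field].
have r10 : 0 < 1 - e by move: e0 rho0 eE; clear; lra.
have r11 : 1 - e < 1 by move: e0; clear; lra.
have r20 : 0 < 1 - 2 * e by move: e0 rho0 eE; clear; lra.
have r21 : 1 - 2 * e < 1 - e by move: e0; clear; lra.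
pose g1 : R := ln (2 * (1 + T)) + pi + 2 * B / e.
exists (expR g1 ^+ 2) => F Fh Fn FT z zr.
have F0 w : cabs w < 1 -> F w != 0 by move=> /Fn/(_ 0%N).
have F1 w : cabs w < 1 -> F w - 1 != 0 by move=> /Fn/(_ 1%N); rewrite subr_eq0.
have [u [uh uE]] := exists_hol_sqrt r10 r11 Fh F0.
have F1h : hol 0 1 (fun w => F w - 1) by apply: holB => //; exact: hol_cst.
have [v [vh vE]] := exists_hol_sqrt r10 r11 F1h F1.
have uv w : cabs w < 1 - e -> (u w - v w) * (u w + v w) = 1.
  by move=> wr; rewrite -subr_sqr (uE w wr) (vE w wr); ring.
have uv0 w : cabs w < 1 - e -> u w - v w != 0.
  move=> /uv H; apply/eqP => H0; move: H; rewrite H0 mul0r => /esym/eqP.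
  by rewrite oner_eq0.
have z0r : cabs (0 : C) < 1 - e by rewrite cabs0.
have [l0 [l0E l0Re l0Im]] := exists_log (uv0 0 z0r).
have uvh : hol 0 (1 - e) (fun w => u w - v w) by exact: holB.
have [G [Gh GE G0]] := exists_hol_log r20 r21 uvh uv0 l0E.
have GF w : cabs w < 1 - 2 * e -> (cexp (G w) + cexp (- G w)) ^+ 2 = 4 * F w.
  move=> wr; have wr' := lt_trans wr r21.
  have -> : cexp (- G w) = u w + v w.
    by apply: (mulfI (uv0 w wr')); rewrite uv // -GE // mulrC cexpNM.
  by rewrite (GE w wr) -(uE w wr'); ring.
have Gnet : omits_net 8 [set w | cabs w < 1 - 2 * e] G.
  move=> p; have [w wp [n wn]] := cosh_net p; exists w => // x /= xr.
  apply/eqP => Gx; have := GF x xr; rewrite Gx wn.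
  have four0 : (4 : C) != 0 by rewrite pnatr_eq0.
  move=> /(mulfI four0) /eqP; rewrite eq_sym; apply/negP; apply: Fn.
  exact: lt_trans (lt_trans xr r21) r11.
have G'B w : cabs (w - 0) < rho + e -> cabs (derive1 G w) <= B / e.
  rewrite subr0 => wr; rewrite ler_pdivlMr //.
  have sub : cabs (w - 0) + e <= 1 - 2 * e by rewrite subr0; move: wr eE; clear; lra.
  apply: HB => //; first exact: (hol_subdisc sub Gh).
  move=> p; have [q qp Gq] := Gnet p; exists q => // x /= xw; apply: Gq => /=.
  by move: sub (cabs_sub_ge x w) xw; rewrite subr0; clear; lra.
have Gh' : hol 0 (rho + e) G.
  by apply: hol_sub Gh; move: eE e0; clear; lra.
have zr' : cabs (z - 0) < rho + e by rewrite subr0; move: zr e0; clear; lra.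
have Gz : cabs (G z) <= g1.
  have M1 := mean_value_inequality Gh' G'B zr'.
  have M2 : 2 * (B / e) * cabs (z - 0) <= 2 * B / e.
    rewrite subr0 -[leRHS]mulr1 mulrA ler_wpM2l ?(le_trans zr (ltW rho1)) //.
    by rewrite divr_ge0 ?mulr_ge0 // ltW.
  have M3 : cabs (G 0) <= ln (2 * (1 + T)) + pi.
    rewrite G0 (le_trans (cabs_le_ReIm _)) // lerD // l0Re.
    have T1 : 0 <= 1 + T by rewrite addr_ge0.
    have sq (q : C) : cabs q ^+ 2 <= 1 + T -> cabs q <= 1 + T.
      move=> h; rewrite -(@ler_pXn2r _ 2) ?nnegrE ?cabs_ge0 // (le_trans h) //.
      by rewrite expr2 ler_peMr // lerDl.
    have cu : cabs (u 0) <= 1 + T.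
      apply: sq; rewrite -cabsX uE //; move: FT; clear; lra.
    have cv : cabs (v 0) <= 1 + T.
      apply: sq; rewrite -cabsX vE // (le_trans (cabs_sub _ _)) // cabs1.
      by move: FT; clear; lra.
    have cT : cabs (u 0) + cabs (v 0) <= 2 * (1 + T) by move: cu cv; clear; lra.
    apply: ln_norm_le; first by rewrite cabs_gt0 uv0.
      exact: le_trans (cabs_sub _ _) cT.
    rewrite -cabsV (_ : (u 0 - v 0)^-1 = u 0 + v 0); last first.
      by apply: (mulfI (uv0 0 z0r)); rewrite uv // divff // uv0.
    exact: le_trans (cabsD _ _) cT.
  have := cabs_sub_ge (G z) (G 0); rewrite /g1; move: M1 M2 M3.
  by set X := 2 * (B / e) * _; clear; lra.
have z2 : cabs z < 1 - 2 * e by move: zr e0 eE; clear; lra.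
have Gz' : cabs (- G z) <= g1 by rewrite cabsN.
have : cabs (cexp (G z) + cexp (- G z)) <= 2 * expR g1.
  have := cabs_cexp_le Gz; have := cabs_cexp_le Gz'.
  have := cabsD (cexp (G z)) (cexp (- G z)); clear; lra.
rewrite -(@ler_pXn2r _ 2) ?nnegrE ?cabs_ge0 ?mulr_ge0 ?expR_ge0 //.
rewrite -cabsX (GF z z2) cabsM cabs_nat exprMn.
by move: (cabs _) (expR _) => X Y; clear; lra.
Qed.

(** A logarithm of [f] divided by [2 pi i] omits all integers, because [f] omits
    1; [avoid_nat_bound] applies to it on a slightly smaller disc. *)
Lemma schottky rho A : 0 < rho -> rho < 1 -> 1 <= A ->
  exists M : R, forall f, hol 0 1 f ->
    (forall z, cabs z < 1 -> f z != 0) -> (forall z, cabs z < 1 -> f z != 1) ->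
    A^-1 <= cabs (f 0) -> cabs (f 0) <= A ->
    forall z, cabs z <= rho -> cabs (f z) <= M.
Proof.
move=> rho0 rho1 A1.
have [r [r0 r1 rr]] : exists r : R, [/\ 0 < r, r < 1 & rho < r].
  by exists ((1 + rho) / 2); split; move: rho0 rho1; clear; lra.
have cr : cabs (cart r 0 : C) = r by rewrite cabs_real gtr0_norm.
have r_neq0 : (cart r 0 : C) != 0 by rewrite -cabs_gt0 cr.
have s0 : 0 < rho / r by rewrite divr_gt0.
have s1 : rho / r < 1 by rewrite ltr_pdivrMr // mul1r.
have T0 : 0 <= ln A + pi by rewrite addr_ge0 ?ln_ge0 // pi_ge0.
have [M HM] := avoid_nat_bound s0 s1 T0.
pose p2 : C := cart 0 (pi *+ 2).
have p2c : 1 <= cabs p2.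
  have pp : 0 <= pi *+ 2 :> R by rewrite mulrn_wge0 // pi_ge0.
  rewrite /p2 cabs_cart expr0n add0r sqrtr_sqr (ger0_norm pp).
  by rewrite mulr2n; have := @pi_ge2 R; clear; lra.
have p20 : p2 != 0 by rewrite -cabs_gt0; exact: (lt_le_trans ltr01 p2c).
exists (expR (cabs p2 * M)) => f fh f0 f1 fA1 fA2 z zr.
have c00 : cabs (0 : C) < 1 by rewrite cabs0.
have [l [lE lRe lIm]] := exists_log (f0 0 c00).
have [L [Lh LE L0]] := exists_hol_log r0 r1 fh f0 lE.
pose F w := p2^-1 * L (0 + cart r 0 * w).
have Fh : hol 0 1 F.
  apply: holM; first exact: hol_cst.
  by apply: hol_affine; rewrite cr // mul1r.
have Fn w : cabs w < 1 -> forall n : nat, F w != n%:R.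
  move=> w1 n; apply/eqP => Fw.
  have wr : cabs (cart r 0 * w) < r.
    by rewrite cabsM cr -[ltRHS]mulr1 ltr_pM2l.
  have := LE _ wr; have -> : L (cart r 0 * w) = p2 *~ n.
    by rewrite -pmulrn -mulr_natr -Fw /F mulrA divff // mul1r add0r.
  rewrite cexp_2pi_int => /esym/eqP; apply/negP; apply: f1.
  exact: lt_trans wr r1.
have FT : cabs (F 0) <= ln A + pi.
  rewrite /F mulr0 addr0 L0 cabsM cabsV.
  have lA : cabs l <= ln A + pi.
    rewrite (le_trans (cabs_le_ReIm _)) // lerD // lRe.
    apply: ln_norm_le => //; first by rewrite cabs_gt0 f0.
    by rewrite -[leRHS]invrK lef_pV2 ?posrE ?invr_gt0 ?cabs_gt0 ?f0 // (lt_le_trans ltr01).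
  apply: le_trans lA; rewrite -[leRHS]mul1r ler_wpM2r ?cabs_ge0 //.
  by rewrite invf_le1 // (lt_le_trans ltr01).
have zz : cabs (z / cart r 0) <= rho / r.
  by rewrite cabs_div cr ler_wpM2r // invr_ge0 ltW.
have := HM F Fh Fn FT _ zz.
rewrite /F add0r mulrCA divff // mulr1 => H.
rewrite -LE; last exact: le_lt_trans zr rr.
apply: cabs_cexp_le.
have -> : L z = p2 * (p2^-1 * L z) by rewrite mulrA divff // mul1r.
by rewrite cabsM ler_wpM2l // cabs_ge0.
Qed.

End SchottkyTheorem.

(** * The Hurwitz density of a twice punctured plane *)

Section PairDensity.
Context {R : realType}.
Local Notation C := (Cplx R).
Implicit Types (r s t x y rho b M T : R) (f g : C -> C) (z l w : C).

Definition pair_domain (w1 w2 : C) : set C := ~` [set w1; w2].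

Lemma pair_domainP (w1 w2 z : C) :
  pair_domain w1 w2 z <-> z != w1 /\ z != w2.
Proof.
rewrite /pair_domain; split.
  by move=> H; split; apply/eqP => E; apply: H; [left|right].
by move=> [/eqP h1 /eqP h2] [].
Qed.

Lemma unit_diskE z : unit_disk z <-> cabs z < 1.
Proof. by rewrite /unit_disk /mkset cabsE -cart1 ltcE /= eqxx. Qed.

Lemma hurwitz_familyE Omega w f : hurwitz_family Omega w f <->
  [/\ hol 0 1 f, (forall z, cabs z < 1 -> Omega (f z)), f 0 = w,
      (forall z, cabs z < 1 -> z != 0 -> f z != w) & 0 < derive1 f 0].
Proof.
split=> [[fh fO f0 fw f']|[fh fO f0 fw f']].
  split=> // [z|z /unit_diskE|z /unit_diskE]; [|exact: fO|exact: fw].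
  rewrite subr0 => /unit_diskE /fh /derivable_has_cderiv fd.
  by exists (derive1 f z).
split=> // [z /unit_diskE zd|z /unit_diskE|z /unit_diskE]; [|exact: fO|exact: fw].
have [|l fl] := fh z; first by rewrite subr0.
by case: (has_cderiv_is_derive fl).
Qed.

(** [hurwitz_radius Omega w] is the supremum of this set. *)
Definition derivative_set (Omega : set C) (w : C) : set R :=
  [set r | exists2 f, hurwitz_family Omega w f & derive1 f 0 = r%:C].

(** Precomposing with a rotation makes the derivative at 0 positive without
    changing its modulus. *)
Lemma rotate_into_family Omega w g l : hol 0 1 g ->
  (forall z, cabs z < 1 -> Omega (g z)) -> g 0 = w ->
  (forall z, cabs z < 1 -> z != 0 -> g z != w) ->
  has_cderiv g 0 l -> l != 0 -> derivative_set Omega w (cabs l).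
Proof.
move=> gh gO g0 gw gl l0.
have cl0 : 0 < cabs l by rewrite cabs_gt0.
pose u : C := cart (cabs l) 0 / l.
have cu : cabs u = 1.
  by rewrite cabs_div cabs_real gtr0_norm // divff // gt_eqF.
have u0 : u != 0 by rewrite -cabs_gt0 cu.
have cuz z : cabs (0 + u * z) = cabs z by rewrite add0r cabsM cu mul1r.
have gu : has_cderiv (fun z => g (0 + u * z)) 0 (cart (cabs l) 0).
  have -> : cart (cabs l) 0 = l * u by rewrite /u mulrC divfK.
  by apply: has_cderiv_affine; rewrite mulr0 addr0.
have [_ du] := has_cderiv_is_derive gu.
exists (fun z => g (0 + u * z)) => //; apply/hurwitz_familyE; split.
- by apply: hol_affine; rewrite cu // mulr1.
- by move=> z z1; apply: gO; rewrite cuz.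
- by rewrite mulr0 addr0.
- by move=> z z1 z0; apply: gw; rewrite ?cuz // add0r mulf_neq0.
- by rewrite du ltcE /= eqxx.
Qed.

(** Schottky's bound holds with one constant for all base points [w] near [w0],
    since it depends on the value at the centre only through its distance to
    [w1]. *)
Lemma schottky_pair w1 w2 w0 rho : w1 != w2 -> w0 != w1 -> 0 < rho -> rho < 1 ->
  exists M, exists2 d : R, 0 < d & forall w, cabs (w - w0) < d ->
    forall f, hurwitz_family (pair_domain w1 w2) w f ->
    forall z, cabs z <= rho -> cabs (f z) <= M.
Proof.
move=> w12 w01 rho0 rho1.
pose p := cabs (w0 - w1); pose q := cabs (w2 - w1).
have p0 : 0 < p by rewrite cabs_gt0 subr_eq0.
have w21 : w2 - w1 != 0 by rewrite subr_eq0 eq_sym.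
have q0 : 0 < q by rewrite cabs_gt0.
have pq0 : 0 < p / q by rewrite divr_gt0.
have qp0 : 0 < q / p by rewrite divr_gt0.
(* After the affine change sending [w1] and [w2] to 0 and 1, the values at the
   centre have modulus between [p / (2 q)] and [2 p / q]. *)
have A1 : 1 <= 1 + 2 * (p / q) + 2 * (q / p) by move: pq0 qp0; clear; lra.
have [M HM] := schottky rho0 rho1 A1.
exists (q * M + cabs w1); exists (p / 2); first by rewrite divr_gt0.
move=> w wd f /hurwitz_familyE[fh fE f0 _ _] z zr.
have wl : p / 2 <= cabs (w - w1).
  by have := cabs_triangle w w0 w1; rewrite -/p (cabsB w0 w); move: wd; clear; lra.
have wu : cabs (w - w1) <= 2 * p.
  by have := cabs_triangle w0 w w1; rewrite -/p; move: wd p0; clear; lra.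
pose h z := (w2 - w1)^-1 * (f z - w1).
have hz (x : C) : cabs (h x) = cabs (f x - w1) / q by rewrite cabsM cabsV mulrC.
have hh : hol 0 1 h.
  by apply: holM; [exact: hol_cst|apply: holB => //; exact: hol_cst].
have h0 (x : C) : cabs x < 1 -> h x != 0.
  move=> /fE /pair_domainP[f1 _]; rewrite mulf_neq0 ?invr_eq0 // subr_eq0.
  exact: f1.
have h1 (x : C) : cabs x < 1 -> h x != 1.
  move=> /fE /pair_domainP[_ f2]; apply/eqP => H; move/eqP: f2; apply.
  have : (w2 - w1) * h x = f x - w1 by rewrite /h mulrA divff // mul1r.
  by rewrite H mulr1 => /addIr.
have hA2 : cabs (h 0) <= 1 + 2 * (p / q) + 2 * (q / p).
  rewrite hz f0; apply: (@le_trans _ _ (2 * (p / q))).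
    by rewrite mulrA ler_wpM2r // invr_ge0 ltW.
  by move: qp0; clear; lra.
have hA1 : (1 + 2 * (p / q) + 2 * (q / p))^-1 <= cabs (h 0).
  rewrite hz f0 -[leRHS]invrK lef_pV2 ?posrE; last 2 first.
  - exact: lt_le_trans A1.
  - by rewrite invr_gt0 divr_gt0 // (lt_le_trans _ wl) // divr_gt0.
  rewrite invf_div; apply: (@le_trans _ _ (2 * (q / p))).
    rewrite ler_pdivrMr; last by rewrite (lt_le_trans _ wl) // divr_gt0.
    have := ler_wpM2l (ltW qp0) wl.
    have -> : q / p * (p / 2) = q / 2 by field; rewrite gt_eqF.
    move: (q / p) (cabs _) => X Y; clear; lra.
  by move: pq0; clear; lra.
have := HM h hh h0 h1 hA1 hA2 z zr.
rewrite hz ler_pdivrMr // mulrC => H.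
by move: H (cabs_sub_ge (f z) w1); clear; lra.
Qed.

Lemma derivative_set_gt0 Omega w r : derivative_set Omega w r -> 0 < r.
Proof.
by move=> [f /hurwitz_familyE[_ _ _ _ f'] fr]; move: f'; rewrite fr ltcE /= eqxx.
Qed.

(** Landau's theorem: without this bound [hurwitz_radius], a supremum in [R],
    would be meaningless. *)
Lemma derivative_set_bounded w1 w2 w : w1 != w2 -> w != w1 ->
  has_ubound (derivative_set (pair_domain w1 w2) w).
Proof.
move=> w12 ww1.
have half0 : 0 < 2^-1 :> R by rewrite invr_gt0.
have half1 : 2^-1 < 1 :> R by clear; lra.
have [M [d d0 HM]] := schottky_pair w12 ww1 half0 half1.
exists (4 * expR 1 * M / 2^-1) => r rS; have r0 := derivative_set_gt0 rS.
case: rS => f fF fr; have /hurwitz_familyE[fh _ _ _ _] := fF.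
have wd : cabs (w - w) < d by rewrite subrr cabs0.
have f0 : has_cderiv f 0 (derive1 f 0).
  by apply: (hol_derive1 fh); rewrite subr0 cabs0.
have fM z : cabs (z - 0) < 2^-1 -> cabs (f z) <= M.
  by rewrite subr0 => zr; apply: (HM w wd f fF); exact: ltW.
have := cauchy_estimate half0 (hol_sub (ltW half1) fh) fM f0.
rewrite fr -/(cart r 0) cabs_real gtr0_norm // => H.
by rewrite ler_pdivlMr.
Qed.

(** The affine map of ratio the distance from [w] to the two omitted points. *)
Lemma derivative_set_inhabited w1 w2 w : w != w1 -> w != w2 ->
  exists2 r, 0 < r & derivative_set (pair_domain w1 w2) w r.
Proof.
move=> ww1 ww2.
pose e := Num.min (cabs (w1 - w)) (cabs (w2 - w)).
have e0 : 0 < e by rewrite lt_min !cabs_gt0 !subr_eq0 ![_ == w]eq_sym ww1.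
have [e1 e2] : e <= cabs (w1 - w) /\ e <= cabs (w2 - w).
  by rewrite /e !ge_min !lexx orbT.
have ce : cabs (cart e 0 : C) = e by rewrite cabs_real gtr0_norm.
have en0 : (cart e 0 : C) != 0 by rewrite -cabs_gt0 ce.
exists (cabs (cart e 0 : C)); first by rewrite ce.
have gd z : has_cderiv (fun z => w + cart e 0 * z) z (1 * cart e 0).
  exact: (has_cderiv_affine (f := fun z => z) (has_cderiv_id _)).
have := gd 0; rewrite mul1r => gd0.
apply: (rotate_into_family _ _ _ _ gd0 en0).
- by move=> z _; exists (1 * cart e 0).
- move=> z z1; have ez : cabs (cart e 0 * z) < e.
    by rewrite cabsM ce -[ltRHS]mulr1 ltr_pM2l.
  apply/pair_domainP; split; apply/eqP => E; move: ez; rewrite ltNge => /negP; apply.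
    by move: e1; rewrite -E addrAC subrr add0r.
  by move: e2; rewrite -E addrAC subrr add0r.
- by rewrite mulr0 addr0.
- move=> z _ z0; rewrite -subr_eq0 addrAC subrr add0r mulf_neq0 //.
Qed.

Lemma hurwitz_radius_gt0 w1 w2 w : w1 != w2 -> w != w1 -> w != w2 ->
  0 < hurwitz_radius (pair_domain w1 w2) w.
Proof.
move=> w12 ww1 ww2; have [r r0 rS] := derivative_set_inhabited ww1 ww2.
apply: (lt_le_trans r0); apply: ub_le_sup => //.
exact: derivative_set_bounded.
Qed.

(** A member [f] of the family at [w] is turned into one at [w0].  The polynomial
    [phi v = v + c (v - w1) (v - w2)] fixes [w1] and [w2], and for
    [c = (w0 - w) / ((w - w1) (w - w2))] it sends [w] to [w0].  It is a small
    perturbation of the identity on bounded sets, hence injective there, and by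
    [schottky_pair] the values of [f] on the disc of radius [rho] are bounded
    independently of [w].  So [phi (f (rho z))] belongs to the family at [w0], up
    to a rotation, and its derivative is close to [rho * f' 0] with [rho] close
    to 1. *)
Lemma hurwitz_radius_usc w1 w2 w0 b : w1 != w2 -> w0 != w1 -> w0 != w2 ->
  hurwitz_radius (pair_domain w1 w2) w0 < b ->
  exists2 d : R, 0 < d & forall w, cabs (w - w0) < d ->
    hurwitz_radius (pair_domain w1 w2) w <= b.
Proof.
move=> w12 w01 w02 r0b; set r0 := hurwitz_radius _ _ in r0b.
have r00 : 0 < r0 by exact: hurwitz_radius_gt0.
have b0 : 0 < b by exact: lt_trans r0b.
(* [rho] and the lower bound [k] of the modulus of [phi' w] satisfy
   [k * rho = r0 / b]: the inequality [k * rho * f' 0 <= r0] is the claim. *)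
have k0 : 0 < r0 / b by rewrite divr_gt0.
have k1 : r0 / b < 1 by rewrite ltr_pdivrMr // mul1r.
have [rho [rho0 rho1 krho]] : exists rho : R, [/\ 0 < rho, rho < 1 & r0 / b < rho].
  by exists ((1 + r0 / b) / 2); split; move: k0 k1; clear; lra.
pose k := r0 / b / rho.
have kp0 : 0 < k by rewrite divr_gt0.
have kp1 : k < 1 by rewrite ltr_pdivrMr // mul1r.
have [M [d1 d10 HM]] := schottky_pair w12 w01 rho0 rho1.
pose m := Num.min (cabs (w0 - w1)) (cabs (w0 - w2)).
have m0 : 0 < m by rewrite lt_min !cabs_gt0 !subr_eq0 w01.
have [m1 m2] : m <= cabs (w0 - w1) /\ m <= cabs (w0 - w2).
  by rewrite /m !ge_min !lexx orbT.
(* [Q] bounds the second factors of all differences [phi v - phi v'] below. *)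
pose Q := 2 * `|M| + cabs w1 + cabs w2 + 1.
have Q0 : 0 < Q by rewrite /Q ltr_wpDl // !addr_ge0 ?cabs_ge0 // mulr_ge0.
pose d2 := (1 - k) * (m / 2) ^+ 2 / Q.
have d20 : 0 < d2.
  by rewrite divr_gt0 // mulr_gt0 ?subr_gt0 // exprn_gt0 // divr_gt0.
exists (Num.min d1 (Num.min (m / 2) d2)).
  by rewrite !lt_min d10 d20 divr_gt0.
move=> w; rewrite !lt_min => /and3P[wd1 wm wd2].
have mw j : m <= cabs (w0 - j) -> m / 2 < cabs (w - j).
  move=> h; have := cabs_triangle w w0 j; rewrite (cabsB w0 w); move: h wm.
  by clear; lra.
have mw1 := mw _ m1; have mw2 := mw _ m2.
have m20 : 0 < m / 2 by rewrite divr_gt0.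
have ww1 : w - w1 != 0 by rewrite -cabs_gt0 (lt_trans m20).
have ww2 : w - w2 != 0 by rewrite -cabs_gt0 (lt_trans m20).
pose c := (w0 - w) / ((w - w1) * (w - w2)).
have cQ : cabs c * Q <= 1 - k.
  rewrite /c cabs_div cabsM -mulrA (mulrC _^-1) mulrA ler_pdivrMr; last first.
    by rewrite mulr_gt0 // (lt_trans m20).
  move: wd2; rewrite /d2 cabsB ltr_pdivlMr // => /ltW/le_trans; apply.
  apply: ler_wpM2l; first by rewrite subr_ge0 ltW.
  by rewrite expr2; apply: ler_pM; exact: ltW.
(* These second factors are of the form [1 + c * u]. *)
have cQ1 u : cabs u <= Q -> 1 + c * u != 0 /\ k <= cabs (1 + c * u).
  move=> uQ; have cu : cabs (c * u) <= 1 - k.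
    by rewrite cabsM (le_trans _ cQ) // ler_wpM2l // cabs_ge0.
  have kk : k <= cabs (1 + c * u).
    by have := cabs_sub_ge 1 (- (c * u)); rewrite opprK cabs1 cabsN; move: cu; clear; lra.
  by split=> //; rewrite -cabs_gt0 (lt_le_trans kp0).
pose phi v := v + c * ((v - w1) * (v - w2)).
have phiw : phi w = w0.
  rewrite /phi /c divfK ?mulf_neq0 //; ring.
apply: ge_sup.
  by have [||r _ rS] := @derivative_set_inhabited w1 w2 w; [rewrite -subr_eq0|rewrite -subr_eq0|exists r].
move=> r rS; have rp := derivative_set_gt0 rS; case: rS => f fF fr.
have /hurwitz_familyE[fh fE f0 fw _] := fF.
have crho : cabs (cart rho 0 : C) = rho by rewrite cabs_real gtr0_norm.
have rho_n0 : (cart rho 0 : C) != 0 by rewrite -cabs_gt0 crho.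
pose p z := f (0 + cart rho 0 * z).
have rz z : cabs z < 1 -> cabs (0 + cart rho 0 * z) <= rho.
  by move=> z1; rewrite add0r cabsM crho -[leRHS]mulr1 ler_wpM2l // ltW.
have rz1 z : cabs z < 1 -> cabs (0 + cart rho 0 * z) < 1.
  by move=> /rz h; exact: le_lt_trans rho1.
have pM z : cabs z < 1 -> cabs (p z) <= `|M|.
  move=> z1; apply: le_trans (ler_norm _); apply: (HM w wd1 f fF); exact: rz.
have wM : cabs w <= `|M|.
  rewrite -f0; apply: le_trans (ler_norm _); apply: (HM w wd1 f fF).
  by rewrite cabs0 ltW.
have cw1 := cabs_ge0 w1; have cw2 := cabs_ge0 w2; have M0 := normr_ge0 M.
have ph : hol 0 1 p.
  apply: hol_affine; rewrite crho // mul1r; apply: hol_sub fh; exact: ltW.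
have f'0 : has_cderiv f 0 (cart r 0).
  have frc : derive1 f 0 = cart r 0 by exact: fr.
  by rewrite -frc; apply: (hol_derive1 fh); rewrite subr0 cabs0.
have pd : has_cderiv p 0 (cart r 0 * cart rho 0).
  by apply: has_cderiv_affine; rewrite mulr0 addr0.
have p0 : p 0 = w by rewrite /p mulr0 addr0.
have gh : hol 0 1 (fun z => phi (p z)).
  apply: holD => //; apply: holM; first exact: hol_cst.
  by apply: holM; apply: holB => //; exact: hol_cst.
have d1' := has_cderivD pd (has_cderiv_cst (- w1) 0).
have d2' := has_cderivD pd (has_cderiv_cst (- w2) 0).
have gd := has_cderivD pd (has_cderivM (has_cderiv_cst c 0) (has_cderivM d1' d2')).
rewrite /= p0 !addr0 mul0r add0r in gd.
set l := (_ + _) in gd.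
have lE : l = (1 + c * (w + w - w1 - w2)) * (cart r 0 * cart rho 0).
  by rewrite /l; ring.
have wQ : cabs (w + w - w1 - w2) <= Q.
  have h1 := cabsD w w; have h2 := cabs_sub (w + w) w1.
  have h3 := cabs_sub (w + w - w1) w2; rewrite /Q.
  by move: h1 h2 h3 wM; clear; lra.
have [l1 lk] := cQ1 _ wQ.
have cr : cabs (cart r 0 : C) = r by rewrite cabs_real gtr0_norm.
have l0 : l != 0.
  by rewrite lE !mulf_neq0 // -cabs_gt0 cr.
have lS : derivative_set (pair_domain w1 w2) w0 (cabs l).
  apply: (rotate_into_family gh _ _ _ gd l0).
  - move=> z z1; have /pair_domainP[q1 q2] := fE _ (rz1 z z1).
    have pz := pM z z1; rewrite -/(p z) in q1 q2.
    apply/pair_domainP; split; rewrite -subr_eq0.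
      have -> : phi (p z) - w1 = (p z - w1) * (1 + c * (p z - w2)).
        by rewrite /phi; ring.
      rewrite mulf_neq0 ?subr_eq0 //; apply: (proj1 (cQ1 _ _)).
      have := cabs_sub (p z) w2; rewrite /Q; move: pz M0 cw1; clear; lra.
    have -> : phi (p z) - w2 = (p z - w2) * (1 + c * (p z - w1)).
      by rewrite /phi; ring.
    rewrite mulf_neq0 ?subr_eq0 //; apply: (proj1 (cQ1 _ _)).
    have := cabs_sub (p z) w1; rewrite /Q; move: pz M0 cw2; clear; lra.
  - by rewrite p0.
  - move=> z z1 z0; have pz := pM z z1.
    have pw : p z != w.
      by apply: fw; [exact: rz1|rewrite add0r mulf_neq0].
    rewrite -phiw -subr_eq0.
    have -> : phi (p z) - phi w = (p z - w) * (1 + c * (p z + w - w1 - w2)).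
      by rewrite /phi; ring.
    rewrite mulf_neq0 ?subr_eq0 //; apply: (proj1 (cQ1 _ _)).
    have h1 := cabsD (p z) w; have h2 := cabs_sub (p z + w) w1.
    have h3 := cabs_sub (p z + w - w1) w2; rewrite /Q.
    by move: h1 h2 h3 wM pz; clear; lra.
have lr0 : cabs l <= r0.
  by apply: ub_le_sup => //; exact: derivative_set_bounded.
have : k * (r * rho) <= r0.
  apply: le_trans lr0; rewrite lE cabsM cabsM cr crho ler_wpM2r //.
  by rewrite mulr_ge0 // ltW.
have -> : k * (r * rho) = r0 * (r / b).
  by rewrite /k; field; rewrite !gt_eqF.
by rewrite -[leRHS]mulr1 ler_pM2l // ler_pdivrMr // mul1r.
Qed.

Lemma hurwitz_density_lsc w1 w2 w0 (a : R) : w1 != w2 -> w0 != w1 -> w0 != w2 ->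
  a < hurwitz_density (pair_domain w1 w2) w0 ->
  exists2 d : R, 0 < d & forall w, cabs (w - w0) < d -> w != w1 -> w != w2 ->
    a < hurwitz_density (pair_domain w1 w2) w.
Proof.
move=> w12 w01 w02; rewrite /hurwitz_density.
set r0 := hurwitz_radius _ _ => ar0.
have r00 : 0 < r0 by exact: hurwitz_radius_gt0.
(* [b] lies between the radius at [w0] and [2 / a], the latter being
   infinite when [a] is not positive. *)
have [b r0b ab] : exists2 b : R, r0 < b & a * b < 2.
  have [a0|a0] := leP a 0.
    exists (r0 + 1); first by rewrite ltrDl.
    by apply: (@le_lt_trans _ _ 0) => //; rewrite mulr_le0_ge0 // addr_ge0 // ltW.
  exists ((r0 + 2 / a) / 2).
    by move: ar0; rewrite ltr_pdivlMr // mulrC -ltr_pdivlMr //; clear; lra.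
  move: ar0; rewrite ltr_pdivlMr // => ar0.
  have -> : a * ((r0 + 2 / a) / 2) = (a * r0 + 2) / 2 by field; rewrite gt_eqF.
  by move: ar0; clear; lra.
have [d d0 H] := hurwitz_radius_usc w12 w01 w02 r0b.
exists d => // w wd ww1 ww2; have rw := hurwitz_radius_gt0 w12 ww1 ww2.
rewrite ltr_pdivlMr //; have rb := H w wd.
have [a0|a0] := leP a 0.
  by apply: (@le_lt_trans _ _ 0) => //; rewrite mulr_le0_ge0 // ltW.
by apply: le_lt_trans ab; rewrite ler_wpM2l // ltW.
Qed.

End PairDensity.

(** * Lower semicontinuity of the supremum *)

Theorem theorem4p5 (R : realType) (Omega : set (Cplx R))
    (domOmega : domain Omega) (hypOmega : hyperbolic Omega) :
  lower_semicontinuous (hurwitz_sup_density Omega : subspace Omega -> \bar R).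
Proof.
move=> w0 a aw0.
(* Outside of [Omega] the points of the subspace topology are isolated. *)
have [Ow0|Ow0] := pselect (Omega w0); last first.
  exists [set w0]; last by move=> _ ->.
  by case: (@nbhs_subspaceP _ Omega w0) => // _ _ ->.
have := aw0; rewrite /hurwitz_sup_density => /ereal_sup_gt[_ [w1 [w2 [w12 Ow1 Ow2 ->]]]].
have Onot (w w' : Cplx R) : Omega w -> ~ Omega w' -> w != w'.
  by move=> Ow nOw'; apply/eqP => E; apply: nOw'; rewrite -E.
rewrite lte_fin => aw.
have [d d0 H] := hurwitz_density_lsc w12 (Onot _ _ Ow0 Ow1) (Onot _ _ Ow0 Ow2) aw.
exists [set w | Omega w /\ cabs (w - w0) < d].
  case: (@nbhs_subspaceP _ Omega w0) => // _.
  by apply/cnbhsP; exists d => // w wd Ow; split.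
move=> w [Ow wd]; apply: (@lt_le_trans _ _ (hurwitz_density (pair_domain w1 w2) w)%:E).
  by rewrite lte_fin; apply: H => //; exact: Onot.
by apply: ereal_sup_ubound; exists w1, w2.
Qed.
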